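(* Let $m\ge 1$ be a fixed natural number, $k$ a non-negative integer, $\underline\lambda=(\lambda_1,\dots,\lambda_m)\in\mathbb{R}^m$, $\mu\in\mathbb{R}$ and $\delta=\mu-\sum_{j=1}^m\lambda_j$. Fix a principal symbol $\sigma^\alpha$, i.e. non-singular matrices $\alpha$. For $\delta\notin\{1,\tfrac32,2,\dots,k\}$, there exists a unique $\mathfrak{sl}(2)$-equivariant symbol map $\sigma_{\underline\lambda;\mu}:\mathcal{D}_{\underline\lambda;\mu}\to\mathcal{S}_\delta$ such that, for each $A\in\mathcal{D}^k_{\underline\lambda;\mu}$, the term of highest order of $\sigma_{\underline\lambda;\mu}(A)$ is the principal symbol $\sigma^\alpha(A)$.
   Context: $M$ is $\mathbb{R}$ or $S^1$. For $\lambda\in\mathbb{R}$, $\mathcal{F}_\lambda$ is the space of weighted densities $a\,(dx)^\lambda$ on $M$, with the $\mathrm{Vect}(M)$-action $L_X^\lambda(a\,(dx)^\lambda)=(X(a)+\lambda\,a\,\mathrm{div}X)(dx)^\lambda$. Multi-indices $\underline i=(i_1,\dots,i_m)$ have non-negative integer entries and $|\underline i|=\sum_j i_j$. $\mathcal{D}^p_{\underline\lambda;\mu}$ is the space of $m$-ary differential operators of order $\le p$, $A=\sum_{|\underline i|\le p}a_{\underline i}\,\partial_{\underline i}:\mathcal{F}_{\lambda_1}\otimes\cdots\otimes\mathcal{F}_{\lambda_m}\to\mathcal{F}_\mu$, with $a_{\underline i}$ smooth functions on $M$ and $\partial_{\underline i}(\varphi_1,\dots,\varphi_m)=\varphi_1^{(i_1)}\cdots\varphi_m^{(i_m)}$;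 $\mathcal{D}_{\underline\lambda;\mu}=\bigcup_p\mathcal{D}^p_{\underline\lambda;\mu}$ is the space of operators of all orders. It is a $\mathrm{Vect}(M)$-module via $L_X^{\underline\lambda;\mu}(A)=L_X^\mu\circ A-\sum_{j=1}^m A(\dots,L_X^{\lambda_j}(-),\dots)$. The space of symbols is the graded module $\mathcal{S}_\delta=\bigoplus_{p\ge0}\mathcal{D}^p_{\underline\lambda;\mu}/\mathcal{D}^{p-1}_{\underline\lambda;\mu}$; its $p$-th summand is isomorphic to the direct sum of $\binom{p+m-1}{m-1}$ copies of $\mathcal{F}_{\delta-p}$, indexed by the multi-indices of weight $p$. The principal symbol $\sigma^\alpha$ attached to non-singular matrices $\alpha=(\alpha^{\underline s}_{\underline i})_{|\underline s|=|\underline i|=p}$ (one for each order $p$) is the $\mathrm{Vect}(M)$-equivariant map sending an operator $A$ of order $p$ to $\bigoplus_{|\underline i|=p}\big(\sum_{|\underline s|=p}\alpha^{\underline s}_{\underline i}a_{\underline s}\big)(dx)^{\delta-p}$; it induces an isomorphism from $\mathcal{D}^p_{\underline\lambda;\mu}/\mathcal{D}^{p-1}_{\underline\lambda;\mu}$ onto that direct sum of copies of $\mathcal{F}_{\delta-p}$. A symbol map is a linear bijection $\mathcal{D}_{\underline\lambda;\mu}\to\mathcal{S}_\delta$ such that the highest-order term of the image of $A$ coincides with the principal symbol $\sigma^\alpha(A)$. $\mathfrak{sl}(2)=\mathrm{Span}\{\partial_x,x\partial_x,x^2\partial_x\}$ is embedded into $\mathrm{Vect}(M)$ via infinitesimal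 projective transformations.
   Formalization: As δ avoids resonances only up to k, sl(2)-equivariance and uniqueness are claimed on D^k (on all of D only if δ avoids them for every k); on all of D the claim fails, e.g. m=1, k=0, δ=1, λ≠0. *)

(* Defs.v *)
From HB Require Import structures.
From mathcomp Require Import all_boot all_order all_algebra.
From mathcomp Require Import all_classical all_reals all_analysis.

Set Implicit Arguments.
Unset Strict Implicit.
Unset Printing Implicit Defensive.

Import Order.TTheory GRing.Theory Num.Theory.
Import numFieldNormedType.Exports.
Local Open Scope classical_set_scope.
Local Open Scope ring_scope.

Inductive manifold := line | circle.

(* The circle is R / (2 pi Z): functions on it are 2 pi - periodic functions of
   the angular coordinate, and this coordinate is used in all the formulas
   below (derivatives, divergence, weighted densities). *)
Definition smooth (R : realType) (M : manifold) : {pred R -> R} :=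
  fun f => `[< (forall n x, derivable (derive1n n f) x 1) /\
               (M = circle -> periodic f (pi *+ 2)) >].

Section SmoothClosure.
Variables (R : realType) (M : manifold).
Implicit Types f g : R -> R.

Lemma smoothP f :
  reflect ((forall n x, derivable (derive1n n f) x 1) /\
           (M = circle -> periodic f (pi *+ 2))) (f \in smooth M).
Proof. exact: asboolP. Qed.

Lemma derive1n_lin (c : R) f g n :
  (forall n x, derivable (derive1n n f) x 1) -> (forall n x, derivable (derive1n n g) x 1) ->
  derive1n n (c *: f + g) = c *: derive1n n f + derive1n n g.
Proof.
move=> df dg; elim: n => [//|n IHn]; rewrite !derive1nS IHn.
apply/funext => x; rewrite derive1E (deriveD (@derivableZ _ _ _ _ c _ _ (df n x)) (dg n x)).
by rewrite (@deriveZ _ _ _ _ c _ _ (df n x)) -!derive1E.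
Qed.

Lemma smooth_lin (c : R) f g :
  f \in smooth M -> g \in smooth M -> c *: f + g \in smooth M.
Proof.
move=> /smoothP[df pf] /smoothP[dg pg]; apply/smoothP; split=> [n x|MC u].
  rewrite (derive1n_lin c n df dg).
  exact: (derivableD (@derivableZ _ _ _ _ c _ _ (df n x)) (dg n x)).
by rewrite !fctE pf ?pg.
Qed.

Lemma derive1n_cst (c : R) n x : derivable (derive1n n (cst c : R -> R)) x 1.
Proof.
elim: n c => [|n IHn] c; first exact: derivable_cst.
rewrite derive1Sn (_ : derive1 _ = cst 0); first exact: IHn.
by apply/funext => y; rewrite derive1_cst.
Qed.

Lemma smooth_cst (c : R) : cst c \in smooth M.
Proof. by apply/smoothP; split=> // n x; apply: derive1n_cst. Qed.

Fixpoint nderivable (n : nat) f : Prop :=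
  (forall x, derivable f x 1) /\
  (if n is k.+1 then nderivable k (derive1 f) else True).

Lemma nderivableP f :
  (forall n, nderivable n f) <-> (forall n x, derivable (derive1n n f) x 1).
Proof.
split=> [Hf n|Hf n]; move: f Hf; elim: n => [|n IHn] f Hf.
- by have [] := Hf 0%N.
- by rewrite derive1Sn; apply: IHn => j; have [] := Hf j.+1.
- by split=> //; exact: (Hf 0%N).
- split; first exact: (Hf 0%N).
  by apply: IHn => j x; rewrite -derive1Sn; exact: Hf.
Qed.

Lemma nderivableW n f : nderivable n.+1 f -> nderivable n f.
Proof. by elim: n f => [|n IHn] f [df Hf]; split=> //; exact: IHn. Qed.

Lemma nderivableD n f g :
  nderivable n f -> nderivable n g -> nderivable n (f + g).
Proof.
elim: n f g => [|n IHn] f g [df Hf] [dg Hg].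
  by split; [move=> x; apply: (derivableD (df x) (dg x)) | exact: I].
split; first by move=> x; apply: (derivableD (df x) (dg x)).
have -> : derive1 (f + g) = derive1 f + derive1 g.
  by apply/funext => x; rewrite derive1E (deriveD (df x) (dg x)) -!derive1E.
exact: IHn.
Qed.

Lemma derive1M f g : (forall x, derivable f x 1) -> (forall x, derivable g x 1) ->
  derive1 (f * g) = derive1 f * g + f * derive1 g.
Proof.
move=> df dg; apply/funext => x; rewrite derive1E (deriveM (df x) (dg x)).
rewrite -!derive1E addrC; congr (_ + _); exact: mulrC.
Qed.

Lemma nderivableM n f g :
  nderivable n f -> nderivable n g -> nderivable n (f * g).
Proof.
elim: n f g => [|n IHn] f g Hf Hg; have [df Hf'] := Hf; have [dg Hg'] := Hg.
  by split; [move=> x; apply: (derivableM (df x) (dg x)) | exact: I].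
split; first by move=> x; apply: (derivableM (df x) (dg x)).
rewrite (derive1M df dg); apply: nderivableD.
  exact: IHn Hf' (nderivableW Hg).
exact: IHn (nderivableW Hf) Hg'.
Qed.

Lemma smooth_mul f g :
  f \in smooth M -> g \in smooth M -> f * g \in smooth M.
Proof.
move=> /smoothP[df pf] /smoothP[dg pg]; apply/smoothP; split; last first.
  by move=> MC u; rewrite !mulrfctE (pf MC) (pg MC).
apply/(nderivableP (f * g)) => n; apply: nderivableM.
  exact: ((nderivableP f).2 df n).
exact: ((nderivableP g).2 dg n).
Qed.

Lemma smooth_derive f : f \in smooth M -> derive1 f \in smooth M.
Proof.
move=> /smoothP[df pf]; apply/smoothP; split.
  by move=> n x; rewrite -derive1Sn; apply: df.
move=> MC u; rewrite /derive1; congr (lim _).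
rewrite (_ : (fun h => _) = (fun h => h^-1 *: (f (h + u) - f u))) //.
by apply/funext => h; rewrite addrA !pf.
Qed.

Lemma smooth_subring : subring_closed (@smooth R M).
Proof.
split; first exact: smooth_cst.
  by move=> f g Sf Sg; rewrite addrC -scaleN1r; apply: smooth_lin.
exact: smooth_mul.
Qed.

Lemma smooth_scale : scaler_closed (@smooth R M).
Proof.
move=> c f Sf; rewrite -[_ *: _]addr0; apply: smooth_lin => //; exact: smooth_cst.
Qed.

HB.instance Definition _ := GRing.isSubringClosed.Build (R -> R) (@smooth R M)
  smooth_subring.
HB.instance Definition _ := GRing.isScaleClosed.Build R (R -> R) (@smooth R M)
  smooth_scale.

End SmoothClosure.

(* C^oo(M).  Through the global coordinate it also stands for Vect(M) (the
   function X standing for X d/dx) and for each space of densities F_lambda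
   (the function a standing for a (dx)^lambda). *)
Record Cinf (R : realType) (M : manifold) :=
  MkCinf { cfun :> R -> R; _ : cfun \in smooth M }.

HB.instance Definition _ (R : realType) (M : manifold) :=
  [isSub for @cfun R M].
HB.instance Definition _ (R : realType) (M : manifold) :=
  [Choice of Cinf R M by <:].
HB.instance Definition _ (R : realType) (M : manifold) :=
  [SubChoice_isSubComNzRing of Cinf R M by <:].
HB.instance Definition _ (R : realType) (M : manifold) :=
  [SubZmodule_isSubLmodule of Cinf R M by <:].

Section Densities.
Variables (R : realType) (M : manifold).
Implicit Types (X a : Cinf R M).

Lemma cder_subproof a : derive1 (cfun a) \in smooth M.
Proof. exact: smooth_derive (valP a). Qed.

Definition cder a : Cinf R M := MkCinf (cder_subproof a).

(* The derivative of X is also div X. *)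
Definition dens_act (lambda : R) X a : Cinf R M :=
  X * cder a + lambda *: (a * cder X).

(* On the circle, seen as the projective line with affine coordinate
   x = tan (theta / 2), the fields d/dx, x d/dx and x^2 d/dx are respectively
   (1 + cos theta) d/dtheta, sin theta d/dtheta and (1 - cos theta) d/dtheta. *)
Definition in_sl2 X : Prop := exists a b c : R,
  match M with
  | line => forall x : R, X x = a + b * x + c * x ^+ 2
  | circle => forall x : R,
      X x = a * (1 + cos x) + b * sin x + c * (1 - cos x)
  end.

End Densities.

(* The multi-indices of weight p: their entries are automatically <= p. *)
Definition mindex (m p : nat) : predArgType :=
  {i : {ffun 'I_m -> 'I_p.+1} | (\sum_j i j)%N == p}.

(* A family of functions indexed by all multi-indices, graded by weight. *)
Definition family_of (R : realType) (M : manifold) (m : nat) : Type :=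
  {p : nat & mindex m p} -> Cinf R M.

HB.instance Definition _ (R : realType) (M : manifold) (m : nat) :=
  GRing.Lmodule.copy (family_of R M m) ({p : nat & mindex m p} -> Cinf R M).

Definition term (R : realType) (M : manifold) (m : nat) (s : family_of R M m)
  (p : nat) (i : mindex m p) : Cinf R M := s (Tagged (mindex m) i).

Definition oper (R : realType) (M : manifold) (m : nat) : Type :=
  ('I_m -> Cinf R M) -> Cinf R M.

HB.instance Definition _ (R : realType) (M : manifold) (m : nat) :=
  GRing.Lmodule.copy (oper R M m) (('I_m -> Cinf R M) -> Cinf R M).

Definition partial (R : realType) (M : manifold) (m p : nat) (i : mindex m p) :
    oper R M m :=
  fun phi => \prod_j iter (val i j) (@cder R M) (phi j).

(* The operator of order <= p with coefficients a; the functions [a i] with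
   [i] of weight > p are ignored. *)
Definition op_of_coef (R : realType) (M : manifold) (m p : nat)
    (a : family_of R M m) : oper R M m :=
  fun phi => \sum_(q < p.+1) \sum_(i : mindex m q) term a i * partial i phi.

Definition is_diffop (R : realType) (M : manifold) (m : nat) : {pred oper R M m} :=
  fun A => `[< exists p a, A = op_of_coef p a >].

Definition subst_arg (R : realType) (M : manifold) (m : nat) (j : 'I_m)
    (L : Cinf R M -> Cinf R M) (phi : 'I_m -> Cinf R M) : 'I_m -> Cinf R M :=
  fun l => if l == j then L (phi l) else phi l.

Definition oper_act (R : realType) (M : manifold) (m : nat) (lambda : 'I_m -> R)
    (mu : R) (X : Cinf R M) (A : oper R M m) : oper R M m :=
  fun phi => dens_act mu X (A phi)
             - \sum_j A (subst_arg j (dens_act (lambda j) X) phi).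

Section DiffopClosure.
Variables (R : realType) (M : manifold) (m : nat).
Implicit Types (A B : oper R M m) (a b : family_of R M m) (f g X : Cinf R M).
Implicit Types (phi : 'I_m -> Cinf R M) (e : 'I_m -> nat).

Lemma is_diffopP A :
  reflect (exists p a, A = op_of_coef p a) (A \in @is_diffop R M m).
Proof. exact: asboolP. Qed.

Lemma operD A B phi : (A + B) phi = A phi + B phi. Proof. by []. Qed.

Lemma operN A phi : (- A) phi = - A phi. Proof. by []. Qed.

Lemma operZ (c : R) A phi : (c *: A) phi = c *: A phi. Proof. by []. Qed.

Definition operE := (operD, operN, operZ).

Lemma oper_sumE (I : Type) (r : seq I) (P : pred I) (F : I -> oper R M m) phi :
  (\sum_(i <- r | P i) F i) phi = \sum_(i <- r | P i) F i phi.
Proof. by elim/big_rec2: _ => // i y A _ <-. Qed.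

Lemma CinfZl (c : R) f g : (c *: f) * g = c *: (f * g).
Proof. by apply/val_inj/funext => x; symmetry; exact: mulrA. Qed.

Lemma op_of_coef_lin p (c : R) a b :
  op_of_coef p (c *: a + b) = c *: op_of_coef p a + op_of_coef p b.
Proof.
apply/funext => phi; rewrite !operE /op_of_coef scaler_sumr -big_split /=.
apply: eq_bigr => q _; rewrite scaler_sumr -big_split /=; apply: eq_bigr => i _.
by rewrite -CinfZl -mulrDl.
Qed.

Lemma op_of_coef_widen p q a : (p <= q)%N -> exists b,
  op_of_coef p a = op_of_coef q b.
Proof.
move=> pq; exists (fun t => if (tag t <= p)%N then a t else 0).
apply/funext => phi; rewrite /op_of_coef.
rewrite (big_ord_widen q.+1 (fun r : nat =>
  \sum_(i : mindex m r) term a i * partial i phi))//.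
rewrite big_mkcond; apply: eq_bigr => r _; rewrite ltnS /term /=.
by case: ifP => // _; rewrite big1// => i _; rewrite mul0r.
Qed.

Lemma is_diffop_submod : submod_closed (@is_diffop R M m).
Proof.
split=> [|c A B /is_diffopP[p [a ->]] /is_diffopP[q [b ->]]].
  apply/is_diffopP; exists 0%N, 0; apply/funext => phi.
  by rewrite /op_of_coef big1// => r _; rewrite big1// => i _; rewrite mul0r.
have [a' ->] := op_of_coef_widen a (leq_maxl p q).
have [b' ->] := op_of_coef_widen b (leq_maxr p q).
by apply/is_diffopP; exists (maxn p q), (c *: a' + b'); rewrite op_of_coef_lin.
Qed.

HB.instance Definition _ := GRing.isSubmodClosed.Build R (oper R M m)
  (@is_diffop R M m) is_diffop_submod.

Definition monomial f e : oper R M m :=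
  fun phi => f * \prod_j iter (e j) (@cder R M) (phi j).

Lemma monomial_diffop f e : monomial f e \in @is_diffop R M m.
Proof.
pose p := (\sum_j e j)%N.
have ep j : (e j < p.+1)%N by rewrite ltnS /p (bigD1 j)//= leq_addr.
pose i : {ffun 'I_m -> 'I_p.+1} := [ffun j => inord (e j)].
have iE j : i j = e j :> nat by rewrite ffunE inordK.
have ip : (\sum_j i j)%N == p by apply/eqP/eq_bigr => j _; rewrite iE.
pose i0 : mindex m p := exist _ i ip.
apply/is_diffopP; exists p, (fun t => if t == Tagged (mindex m) i0 then f else 0).
apply/funext => phi; rewrite /op_of_coef big_ord_recr /= big1 ?add0r; last first.
  move=> q _; rewrite big1// => k _; rewrite /term /=; case: eqP => [E|]; last by rewrite mul0r.
  by exfalso; have := ltn_ord q; have /= -> := congr1 tag E; rewrite ltnn.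
rewrite (bigD1 i0)//= [X in _ + X]big1 ?addr0 => [|k kN].
  rewrite /term eqxx /monomial; congr (_ * _); apply: eq_bigr => j _.
  by rewrite -iE.
by rewrite /term eq_Tagged /= (negbTE kN) mul0r.
Qed.

Lemma cderD : {morph @cder R M : f g / f + g}.
Proof.
move=> f g; apply/val_inj/funext => x /=; rewrite !fctE !derive1E deriveD//.
  by have /smoothP[+ _] := valP f => /(_ 0%N x).
by have /smoothP[+ _] := valP g => /(_ 0%N x).
Qed.

Lemma cderM f g : cder (f * g) = cder f * g + f * cder g.
Proof.
apply/val_inj/funext => x /=; rewrite !fctE !derive1E deriveM.
- by rewrite addrC; congr (_ + _); rewrite [LHS]mulrC.
- by have /smoothP[+ _] := valP f => /(_ 0%N x).
by have /smoothP[+ _] := valP g => /(_ 0%N x).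
Qed.

Lemma cder0 : cder 0 = 0 :> Cinf R M.
Proof. by apply: (addrI (cder 0)); rewrite -cderD !addr0. Qed.

Lemma cder1 : cder 1 = 0 :> Cinf R M.
Proof.
apply: (addrI (cder 1)); rewrite addr0 -[RHS](congr1 (@cder R M) (mulr1 1)).
by rewrite cderM mulr1 mul1r.
Qed.

Lemma cder_prod (I : eqType) (r : seq I) (F : I -> Cinf R M) : uniq r ->
  cder (\prod_(j <- r) F j) =
  \sum_(j <- r) \prod_(l <- r) if l == j then cder (F l) else F l.
Proof.
elim: r => [_|k r IHr /= /andP[kr ur]]; first by rewrite !big_nil cder1.
rewrite !big_cons cderM IHr// eqxx; congr (_ * _ + _).
  rewrite !big_seq; apply: eq_bigr => l lr; case: eqP => // E.
  by rewrite -E lr in kr.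
rewrite mulr_sumr !big_seq; apply: eq_bigr => j jr; rewrite big_cons.
by case: eqP => // E; rewrite E jr in kr.
Qed.

Lemma diffop_ind (P : oper R M m -> Prop) : P 0 ->
  (forall A B, P A -> P B -> P (A + B)) ->
  (forall f e, P (monomial f e)) -> forall A, A \in @is_diffop R M m -> P A.
Proof.
move=> P0 PD Pm A /is_diffopP[p [a ->]].
rewrite (_ : op_of_coef p a = \sum_(q < p.+1) \sum_(i : mindex m q)
    (fun phi => term a i * partial i phi)); last first.
  apply/funext => phi; rewrite oper_sumE; apply: eq_bigr => q _.
  by rewrite oper_sumE.
apply: (big_ind P) => // q _; apply: (big_ind P) => // i _.
exact: (Pm _ (fun j => val i j)).
Qed.

Lemma diffop_mul f A : A \in @is_diffop R M m ->
  (fun phi => f * A phi) \in @is_diffop R M m.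
Proof.
move: A; apply: (diffop_ind (P := fun A => (fun phi => f * A phi) \in @is_diffop R M m)).
- rewrite (_ : (fun _ => _) = 0) ?rpred0//; apply/funext => phi.
  by rewrite mulr0.
- move=> A B PA PB.
  rewrite (_ : (fun _ => _) = ((fun phi => f * A phi) : oper R M m) + (fun phi => f * B phi)).
    exact: rpredD.
  by apply/funext => phi; rewrite !operE mulrDr.
- move=> g e; rewrite (_ : (fun _ => _) = monomial (f * g) e).
    exact: monomial_diffop.
  by apply/funext => phi; rewrite /monomial mulrA.
Qed.

Lemma diffop_cder A : A \in @is_diffop R M m ->
  (fun phi => cder (A phi)) \in @is_diffop R M m.
Proof.
move: A; apply: (diffop_ind (P := fun A => (fun phi => cder (A phi)) \in @is_diffop R M m)).
- rewrite (_ : (fun _ => _) = 0) ?rpred0//; apply/funext => phi.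
  exact: cder0.
- move=> A B PA PB.
  rewrite (_ : (fun _ => _) = ((fun phi => cder (A phi)) : oper R M m) + (fun phi => cder (B phi))).
    exact: rpredD.
  by apply/funext => phi; rewrite !operE cderD.
- move=> g e; rewrite (_ : (fun _ => _) = monomial (cder g) e +
    \sum_j monomial g (fun l => if l == j then (e l).+1 else e l)).
    by rewrite rpredD ?rpred_sum// => *; exact: monomial_diffop.
  apply/funext => phi; rewrite operE oper_sumE /monomial cderM; congr (_ + _).
  rewrite cder_prod ?index_enum_uniq// mulr_sumr; apply: eq_bigr => j _.
  by congr (_ * _); apply: eq_bigr => l _; case: eqP.
Qed.

Lemma iter_dens_act (c : R) X n : exists s : seq (Cinf R M * nat), forall f,
  iter n (@cder R M) (dens_act c X f) = \sum_(t <- s) t.1 * iter t.2 (@cder R M) f.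
Proof.
elim: n => [|n [s IHs]].
  exists [:: (X, 1%N); (c *: cder X, 0%N)] => f.
  rewrite !big_cons big_nil addr0 /=; congr (_ + _).
  by rewrite CinfZl [cder X * f]mulrC.
exists (flatten [seq [:: (cder t.1, t.2); (t.1, t.2.+1)] | t <- s]) => f.
rewrite /= IHs; elim: s {IHs} => [|t s IHs]; first by rewrite !big_nil cder0.
by rewrite /= !big_cons cderD cderM IHs addrA.
Qed.

Lemma diffop_subst c X j A : A \in @is_diffop R M m ->
  (fun phi => A (subst_arg j (dens_act c X) phi)) \in @is_diffop R M m.
Proof.
move: A; apply: (diffop_ind (P := fun A =>
  (fun phi => A (subst_arg j (dens_act c X) phi)) \in @is_diffop R M m)).
- by rewrite (_ : (fun _ => _) = 0) ?rpred0.
- by move=> A B PA PB; exact: rpredD PA PB.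
- move=> g e; have [s sE] := iter_dens_act c X (e j).
  rewrite (_ : (fun _ => _) = \sum_(t <- s) monomial (g * t.1)
      (fun l => if l == j then t.2 else e l)).
    by rewrite rpred_sum// => *; exact: monomial_diffop.
  apply/funext => phi; rewrite oper_sumE /monomial (bigD1 j)//= /subst_arg eqxx sE.
  rewrite mulr_suml mulr_sumr; apply: eq_bigr => t _.
  rewrite [in RHS](bigD1 j)//= eqxx -!mulrA; congr (_ * (_ * (_ * _))).
  by apply: eq_bigr => l /negbTE->.
Qed.

Lemma oper_act_diffop (lambda : 'I_m -> R) mu X A :
  A \in @is_diffop R M m -> oper_act lambda mu X A \in @is_diffop R M m.
Proof.
move=> DA; pose B : oper R M m := fun phi => X * cder (A phi).
pose C : oper R M m := fun phi => cder X * A phi.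
pose E j : oper R M m := fun phi => A (subst_arg j (dens_act (lambda j) X) phi).
rewrite (_ : oper_act _ _ _ _ = B + mu *: C - \sum_j E j).
  rewrite rpredB ?rpredD ?rpredZ ?rpred_sum//.
  - exact/diffop_mul/diffop_cder.
  - exact: diffop_mul.
  - by move=> j _; exact: diffop_subst.
apply/funext => phi; rewrite !operE oper_sumE /oper_act /dens_act /B /C.
by rewrite [A phi * _]mulrC.
Qed.

End DiffopClosure.

(* D_{lambda; mu}: the underlying space depends neither on lambda nor on mu,
   only the action does. *)
Record diffop (R : realType) (M : manifold) (m : nat) :=
  MkDiffop { oper_of :> oper R M m; _ : oper_of \in @is_diffop R M m }.

HB.instance Definition _ (R : realType) (M : manifold) (m : nat) :=
  [isSub for @oper_of R M m].
HB.instance Definition _ (R : realType) (M : manifold) (m : nat) :=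
  [Choice of diffop R M m by <:].
HB.instance Definition _ (R : realType) (M : manifold) (m : nat) :=
  [SubChoice_isSubZmodule of diffop R M m by <:].
HB.instance Definition _ (R : realType) (M : manifold) (m : nat) :=
  [SubZmodule_isSubLmodule of diffop R M m by <:].

Definition diffop_act (R : realType) (M : manifold) (m : nat)
    (lambda : 'I_m -> R) (mu : R) (X : Cinf R M) (A : diffop R M m) :
    diffop R M m :=
  MkDiffop (oper_act_diffop lambda mu X (valP A)).

Definition order_le (R : realType) (M : manifold) (m p : nat)
    (A : diffop R M m) : Prop :=
  exists a : family_of R M m, oper_of A = op_of_coef p a.

Definition fin_supp (R : realType) (M : manifold) (m : nat) :
    {pred family_of R M m} :=
  fun s => `[< exists p, forall q (i : mindex m q), (p < q)%N -> term s i = 0 >].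

Section SymbolClosure.
Variables (R : realType) (M : manifold) (m : nat).

Lemma fin_suppP (s : family_of R M m) :
  reflect (exists p, forall q (i : mindex m q), (p < q)%N -> term s i = 0)
          (s \in @fin_supp R M m).
Proof. exact: asboolP. Qed.

Lemma fin_supp_submod : submod_closed (@fin_supp R M m).
Proof.
split=> [|c s t /fin_suppP[p sp] /fin_suppP[q tq]]; first by apply/fin_suppP; exists 0%N.
apply/fin_suppP; exists (maxn p q) => r i; rewrite gtn_max => /andP[pr qr].
have := sp r i pr; have := tq r i qr; rewrite /term !fctE => -> ->.
by rewrite scaler0 addr0.
Qed.

HB.instance Definition _ := GRing.isSubmodClosed.Build R (family_of R M m)
  (@fin_supp R M m) fin_supp_submod.

Definition family_act (delta : R) (X : Cinf R M) (s : family_of R M m) :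
    family_of R M m :=
  fun t => dens_act (delta - (tag t)%:R) X (s t).

Lemma family_act_fin_supp delta X s :
  s \in @fin_supp R M m -> family_act delta X s \in @fin_supp R M m.
Proof.
move=> /fin_suppP[p sp]; apply/fin_suppP; exists p => q i pq.
have := sp q i pq; rewrite /term /family_act => ->.
by rewrite /dens_act cder0 mulr0 mul0r scaler0 addr0.
Qed.

End SymbolClosure.

(* S_delta: each graded piece D^p / D^(p-1) is realized as the direct sum of
   copies of F_(delta - p) indexed by the multi-indices of weight p, which is
   where principal symbols take their values.  Only the action depends on
   delta. *)
Record symbol (R : realType) (M : manifold) (m : nat) :=
  MkSymbol { terms :> family_of R M m; _ : terms \in @fin_supp R M m }.

HB.instance Definition _ (R : realType) (M : manifold) (m : nat) :=
  [isSub for @terms R M m].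
HB.instance Definition _ (R : realType) (M : manifold) (m : nat) :=
  [Choice of symbol R M m by <:].
HB.instance Definition _ (R : realType) (M : manifold) (m : nat) :=
  [SubChoice_isSubZmodule of symbol R M m by <:].
HB.instance Definition _ (R : realType) (M : manifold) (m : nat) :=
  [SubZmodule_isSubLmodule of symbol R M m by <:].

Definition symbol_act (R : realType) (M : manifold) (m : nat) (delta : R)
    (X : Cinf R M) (s : symbol R M m) : symbol R M m :=
  MkSymbol (family_act_fin_supp delta X (valP s)).

(* [alpha p] has the upper index of the coefficients alpha^s_i as column
   index. *)
Definition principal_symbol (R : realType) (M : manifold) (m : nat)
    (alpha : forall p, 'M[R]_#|{: mindex m p}|) (p : nat) (a : family_of R M m)
    (i : mindex m p) : Cinf R M :=
  \sum_(s : mindex m p) alpha p (enum_rank i) (enum_rank s) *: term a s.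

(* A differential operator of order <= p determines its coefficients of weight
   <= p, so quantifying over the families a that represent A is harmless.  The
   term of highest order of the image of A is the one of degree p. *)
Definition has_principal_symbol (R : realType) (M : manifold) (m : nat)
    (alpha : forall p, 'M[R]_#|{: mindex m p}|) (p : nat) (A : diffop R M m)
    (s : symbol R M m) : Prop :=
  (exists2 a : family_of R M m, oper_of A = op_of_coef p a &
     forall i : mindex m p, term s i = principal_symbol alpha a i) /\
  (forall q (i : mindex m q), (p < q)%N -> term s i = 0).

Definition symbol_map (R : realType) (M : manifold) (m : nat)
    (alpha : forall p, 'M[R]_#|{: mindex m p}|)
    (sigma : diffop R M m -> symbol R M m) : Prop :=
  [/\ linear sigma, bijective sigma &
      forall p (A : diffop R M m), order_le p A ->
        has_principal_symbol alpha p A (sigma A)].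

Definition weight_shift (R : realType) (m : nat) (lambda : 'I_m -> R) (mu : R) : R :=
  mu - \sum_j lambda j.

(* Equivariance is relative to a set P of operators, in practice either D^k or
   all operators.  If delta is resonant for some order above k only, an
   equivariant symbol map on D^k need not extend to an equivariant one on
   operators of all orders: for m = 1, delta = 1 and lambda <> 0, there is one
   on D^0 but none on D^1. *)
Definition sl2_equivariant_on (R : realType) (M : manifold) (m : nat)
    (lambda : 'I_m -> R) (mu : R) (P : diffop R M m -> Prop)
    (sigma : diffop R M m -> symbol R M m) : Prop :=
  forall (X : Cinf R M) (A : diffop R M m), in_sl2 X -> P A ->
    sigma (diffop_act lambda mu X A) =
    symbol_act (weight_shift lambda mu) X (sigma A).

(* delta is one of 1, 3/2, 2, ..., k. *)
Definition resonant (R : realType) (k : nat) (delta : R) : Prop :=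
  exists2 r : nat, (2 <= r <= k.*2)%N & delta = r%:R / 2.

(* Main.v *)
(* The Casimir operator C of sl(2) acts on the p-th graded piece of the
   operators, a sum of copies of F_(delta - p), by the scalar
   c_p = (delta - p)(delta - p - 1), and c_p = c_q for p <> q only if
   delta = (p + q + 1)/2.  Without resonance, the product of the
   (C - c_q)/(c_p - c_q) over q < p kills the operators of order < p, commutes
   with sl(2) and does not change principal symbols, so applying it to an
   arbitrary operator with a given homogeneous symbol of degree p defines an
   equivariant quantization, whose inverse is the symbol map.  Conversely, an
   equivariant symbol map commutes with C, hence sends an operator of order p
   in the eigenspace of c_p to its principal symbol.  On the line and on the
   circle alike, this only uses a basis X0, X1, X2 of sl(2) with the relations
   of 1, x, x^2. *)
Require Import Defs.
From HB Require Import structures.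
From mathcomp Require Import all_boot all_order all_algebra.
From mathcomp Require Import all_classical all_reals all_analysis.
From mathcomp Require Import ring.

Set Implicit Arguments.
Unset Strict Implicit.
Unset Printing Implicit Defensive.

Import Order.TTheory GRing.Theory Num.Theory.
Import numFieldNormedType.Exports.
Local Open Scope classical_set_scope.
Local Open Scope ring_scope.

(** * Algebra of smooth functions, densities and bases of sl(2) *)

Section SmoothFunctions.
Variables (R : realType) (M : manifold).
Implicit Types (X Y a b f g : Cinf R M) (nu c : R).

(** Scalars are viewed as constant functions through a ring morphism, so that identities mixing
    scalings, products and derivatives are within reach of [ring]. *)
Definition cconst (c : R) : Cinf R M := c *: (1 : Cinf R M).

Lemma cscaleE c f : c *: f = cconst c * f.
Proof. by rewrite /cconst CinfZl mul1r. Qed.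

Lemma cconst_zmod_morphism : zmod_morphism cconst.
Proof. by move=> c d; rewrite /cconst scalerBl. Qed.

Lemma cconst_monoid_morphism : monoid_morphism cconst.
Proof.
by split=> [|c d]; rewrite /cconst ?scale1r// CinfZl mul1r scalerA.
Qed.

HB.instance Definition _ := GRing.isZmodMorphism.Build R (Cinf R M) cconst
  cconst_zmod_morphism.
HB.instance Definition _ := GRing.isMonoidMorphism.Build R (Cinf R M) cconst
  cconst_monoid_morphism.

Lemma cder_cconst c : cder (cconst c) = 0.
Proof.
rewrite (_ : cconst c = MkCinf (smooth_cst M c)).
  by apply/val_inj/funext => x /=; rewrite derive1_cst.
by apply/val_inj/funext => x; exact: mulr1.
Qed.

Lemma cderZ c f : cder (c *: f) = c *: cder f.
Proof. by rewrite !cscaleE cderM cder_cconst mul0r add0r. Qed.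

Lemma cderN f : cder (- f) = - cder f.
Proof. by rewrite -scaleN1r cderZ scaleN1r. Qed.

Lemma dens_actE nu X a : dens_act nu X a = X * cder a + cconst nu * (a * cder X).
Proof. by rewrite /dens_act cscaleE. Qed.

Lemma dens_act_linear nu X : linear (dens_act nu X).
Proof. by move=> c f g; rewrite !dens_actE !cscaleE !(cderD, cderM, cder_cconst); ring. Qed.

HB.instance Definition _ nu X := GRing.isLinear.Build R (Cinf R M) (Cinf R M) _
  (dens_act nu X) (dens_act_linear nu X).

Lemma dens_act_lin nu c X Y a :
  dens_act nu (c *: X + Y) a = c *: dens_act nu X a + dens_act nu Y a.
Proof. by rewrite !dens_actE !cscaleE !(cderD, cderM, cder_cconst); ring. Qed.

Definition bracket X Y : Cinf R M := X * cder Y - cder X * Y.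

Lemma dens_act_bracket nu X Y a :
  dens_act nu (bracket X Y) a =
  dens_act nu X (dens_act nu Y a) - dens_act nu Y (dens_act nu X a).
Proof.
by rewrite !dens_actE /bracket !(cderD, cderN, cderM, cder_cconst); ring.
Qed.

(** What the proof retains of 1, x, x^2. The brackets make the Casimir operator commute with the
    action; the last four identities, together with [bracket02], make it a scalar on densities. *)
Record sl2_triple (X0 X1 X2 : Cinf R M) : Prop := Sl2Triple {
  sl2_triple0 : in_sl2 X0;
  sl2_triple1 : in_sl2 X1;
  sl2_triple2 : in_sl2 X2;
  sl2_triple_span : forall X, in_sl2 X ->
    exists a b c : R, X = a *: X0 + (b *: X1 + c *: X2);
  bracket01 : bracket X0 X1 = X0;
  bracket02 : bracket X0 X2 = X1 *+ 2;
  bracket12 : bracket X1 X2 = X2;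
  sl2_triple_sqr : X1 * X1 = X2 * X0;
  sl2_triple_cder1 : X1 * cder X1 = X1 + X2 * cder X0;
  sl2_triple_cder2 : X1 * cder (cder X1) = cder X1 + X2 * cder (cder X0) - 1;
  sl2_triple_cder_sqr : cder X1 * cder X1 = 1 + cder X2 * cder X0;
}.

(** Collect the coefficients of a'', a' and a. The first is zero by [sl2_triple_sqr], the second by
    [sl2_triple_cder1] and [bracket02]; the last two identities of the triple reduce the third to
    nu^2 - nu. *)
Lemma dens_casimir X0 X1 X2 nu a : sl2_triple X0 X1 X2 ->
  dens_act nu X1 (dens_act nu X1 a) - dens_act nu X1 a
  - dens_act nu X2 (dens_act nu X0 a) = (nu * (nu - 1)) *: a.
Proof.
case=> _ _ _ _ _ E02 _ E1 E2 E3 E4.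
have {}E02 : X0 * cder X2 = cder X0 * X2 + X1 *+ 2.
  by rewrite -E02 /bracket addrC subrK.
rewrite !dens_actE !cscaleE !(cderD, cderM, cder_cconst).
transitivity ((X1 * X1 - X2 * X0) * cder (cder a)
  + ((X1 * cder X1 - X1 - X2 * cder X0)
     + cconst nu * (X1 * cder X1 *+ 2 - X0 * cder X2 - X2 * cder X0)) * cder a
  + (cconst nu * (X1 * cder (cder X1) - cder X1 - X2 * cder (cder X0))
     + cconst nu ^+ 2 * (cder X1 * cder X1 - cder X2 * cder X0)) * a).
  by ring.
by rewrite E02 E1 E2 E3 E4; ring.
Qed.

End SmoothFunctions.

(** * Projective fields and local coordinates on the line and the circle *)

Section SmoothExamples.
Variable R : realType.

Lemma smooth_id : (id : R -> R) \in @smooth R line.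
Proof.
apply/smoothP; split=> // -[|n] x; first exact: derivable_id.
rewrite derive1Sn (_ : derive1 _ = cst (1 : R)); first exact: derive1n_cst.
by apply/funext => y; rewrite derive1_id.
Qed.

Lemma derive1_sin : derive1 (@sin R) = cos.
Proof. by apply/funext => x; rewrite derive1E derive_val. Qed.

Lemma derive1_cos : derive1 (@cos R) = - sin.
Proof. by apply/funext => x; rewrite derive1E derive_val. Qed.

(** Differentiation exchanges the two functions up to sign, hence the joint induction. *)
Lemma nderivable_trigo n : nderivable n (@sin R) /\ nderivable n (@cos R).
Proof.
elim: n => [|n [IHs IHc]].
  by split; split.
split; split=> //; first by rewrite derive1_sin.
rewrite derive1_cos -mulN1r; apply: nderivableM => //.
rewrite (_ : -1 = cst (-1))//.
exact: ((nderivableP (cst (-1 : R))).2 (@derive1n_cst R (-1))).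
Qed.

Lemma smooth_sin : @sin R \in @smooth R circle.
Proof.
apply/smoothP; split; last by move=> _; exact: sinD2pi.
by apply/nderivableP => n; have [] := nderivable_trigo n.
Qed.

Lemma smooth_cos : @cos R \in @smooth R circle.
Proof.
apply/smoothP; split; last by move=> _; exact: cosD2pi.
by apply/nderivableP => n; have [] := nderivable_trigo n.
Qed.

Definition cid_line : Cinf R line := MkCinf smooth_id.
Definition csin : Cinf R circle := MkCinf smooth_sin.
Definition ccos : Cinf R circle := MkCinf smooth_cos.

Lemma cder_id : cder cid_line = 1.
Proof. by apply/val_inj/funext => x /=; rewrite derive1_id. Qed.

Lemma cder_sin : cder csin = ccos.
Proof. by apply/val_inj; rewrite /= derive1_sin. Qed.

Lemma cder_cos : cder ccos = - csin.
Proof. by apply/val_inj; rewrite /= derive1_cos. Qed.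

Lemma csin_sqr : csin * csin = 1 - ccos * ccos.
Proof.
apply/val_inj/funext => x; change (sin x * sin x = 1 - cos x * cos x).
by rewrite -(cos2Dsin2 x) !expr2 addrAC subrr add0r.
Qed.

Lemma sl2_triple_line :
  sl2_triple (1 : Cinf R line) cid_line (cid_line * cid_line).
Proof.
have d2 : cder (cder cid_line) = 0 by rewrite cder_id cder1.
split; rewrite /bracket ?cderM ?cder1 ?cder0 ?d2 ?cder_id ?cder1; try ring.
- by exists 1, 0, 0 => x; rewrite !mul0r !addr0.
- by exists 0, 1, 0 => x; rewrite mul0r mul1r add0r addr0.
- by exists 0, 0, 1 => x; rewrite mul0r mul1r !add0r expr2.
- move=> X [a [b [c E]]]; exists a, b, c; apply/val_inj/funext => x.
  by rewrite [LHS]E /= !fctE /= -addrA expr2 /GRing.scale /= mulr1.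
Qed.

Lemma sl2_triple_circle : sl2_triple (1 + ccos) csin (1 - ccos).
Proof.
have cC := csin_sqr.
split; rewrite /bracket ?(cderD, cderN, cder1, cder0, cder_sin, cder_cos) //.
- by exists 1, 0, 0 => x; rewrite !mul0r !addr0 mul1r.
- by exists 0, 1, 0 => x; rewrite !mul0r mul1r add0r addr0.
- by exists 0, 0, 1 => x; rewrite !mul0r mul1r !add0r.
- move=> X [a [b [c E]]]; exists a, b, c; apply/val_inj/funext => x.
  by rewrite [LHS]E /= !fctE /= -addrA.
- transitivity (ccos * ccos + csin * csin + ccos); first by ring.
  by rewrite cC; ring.
- by ring.
- transitivity (csin * csin + ccos * ccos - ccos); first by ring.
  by rewrite cC; ring.
- by rewrite cC; ring.
- by ring.
- by rewrite mulrN cC; ring.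
- transitivity (1 - (1 - ccos * ccos)); first by ring.
  by rewrite -cC; ring.
Qed.

End SmoothExamples.

Lemma sl2_triple_exists (R : realType) (M : manifold) :
  exists X0 X1 X2 : Cinf R M, sl2_triple X0 X1 X2.
Proof.
case: M.
  by exists 1, (cid_line R), (cid_line R * cid_line R); exact: sl2_triple_line.
by exists (1 + ccos R), (csin R), (1 - ccos R); exact: sl2_triple_circle.
Qed.

(** Evaluating an operator on powers of such a [t] singles out its coefficients at [x0]. *)
Lemma local_coordinate_exists (R : realType) (M : manifold) (x0 : R) :
  exists t : Cinf R M, t x0 = 0 /\ cder t x0 = 1.
Proof.
case: M.
  exists (cid_line R - cconst line x0); rewrite cderD cderN cder_cconst cder_id.
  by rewrite /= !fctE /= subr0 /GRing.scale /= mulr1 subrr.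
(* This is sin (x - x0), which is globally defined on the circle. *)
exists (cos x0 *: csin R - sin x0 *: ccos R).
rewrite cderD cderN !cderZ cder_sin cder_cos /= !fctE /= /GRing.scale /=.
split; first by rewrite mulrC subrr.
by rewrite mulrN opprK -!expr2 cos2Dsin2.
Qed.

(** * The order filtration and uniqueness of coefficients *)

Section Filtration.
Variables (R : realType) (M : manifold) (m : nat).
Implicit Types (A B : diffop R M m) (a b : family_of R M m) (f g X Y : Cinf R M).
Implicit Types (phi : 'I_m -> Cinf R M) (e : 'I_m -> nat) (p q : nat).

Definition monom f e : diffop R M m := MkDiffop (monomial_diffop f e).

Definition homop p a : diffop R M m :=
  \sum_(i : mindex m p) monom (term a i) (fun j => val i j).

Lemma diffop_val_sum (I : Type) (r : seq I) (P : pred I) (F : I -> diffop R M m) phi :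
  oper_of (\sum_(i <- r | P i) F i) phi = \sum_(i <- r | P i) oper_of (F i) phi.
Proof. by elim/big_rec2: _ => // i y A _ <-. Qed.

Lemma diffop_ext A B : (forall phi, oper_of A phi = oper_of B phi) -> A = B.
Proof. by move=> AB; apply/val_inj/funext. Qed.

Lemma homopE p a phi :
  oper_of (homop p a) phi = \sum_(i : mindex m p) term a i * partial i phi.
Proof. exact: diffop_val_sum. Qed.

Lemma monom_lin e (c : R) f g :
  monom (c *: f + g) e = c *: monom f e + monom g e.
Proof.
apply: diffop_ext => phi; rewrite /= !operE /monomial mulrDl.
by rewrite CinfZl.
Qed.

Lemma homop_linear p : linear (homop p).
Proof.
move=> c a b; rewrite /homop scaler_sumr -big_split /=.
by apply: eq_bigr => i _; rewrite -monom_lin.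
Qed.

HB.instance Definition _ p := GRing.isLinear.Build R (family_of R M m)
  (diffop R M m) _ (homop p) (homop_linear p).

Lemma eq_homop p a b :
  (forall i : mindex m p, term a i = term b i) -> homop p a = homop p b.
Proof. by move=> ab; apply: eq_bigr => i _; rewrite ab. Qed.

Lemma op_of_coef_homop p a :
  op_of_coef p a = oper_of (\sum_(q < p.+1) homop q a).
Proof.
by apply/funext => phi; rewrite diffop_val_sum; apply: eq_bigr => q _; rewrite homopE.
Qed.

(** The bound is strict so that [order_lt 0] is the zero space, where inductions on the order start.
    Having a given leading part becomes membership of a difference in a submodule. *)
Definition order_lt p : {pred diffop R M m} :=
  fun A => `[< exists a, A = \sum_(q < p) homop q a >].

Lemma order_ltP p A :
  reflect (exists a, A = \sum_(q < p) homop q a) (A \in order_lt p).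
Proof. exact: asboolP. Qed.

Lemma order_lt_submod p : submod_closed (order_lt p).
Proof.
split=> [|c A B /order_ltP[a ->] /order_ltP[b ->]].
  by apply/order_ltP; exists 0; rewrite big1// => q _; rewrite linear0.
apply/order_ltP; exists (c *: a + b); rewrite scaler_sumr -big_split /=.
by apply: eq_bigr => q _; rewrite linearP.
Qed.

HB.instance Definition _ p := GRing.isSubmodClosed.Build R (diffop R M m)
  (order_lt p) (order_lt_submod p).

Lemma order_leE p A : order_le p A <-> A \in order_lt p.+1.
Proof.
split=> [[a AE]|/order_ltP[a AE]].
  by apply/order_ltP; exists a; apply/val_inj; rewrite /= AE op_of_coef_homop.
by exists a; rewrite op_of_coef_homop AE.
Qed.

Lemma order_lt0 A : A \in order_lt 0 -> A = 0.
Proof. by case/order_ltP => a ->; rewrite big_ord0. Qed.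

Lemma order_lt_ex A : exists p, A \in order_lt p.
Proof.
have /is_diffopP[p [a AE]] := valP A; exists p.+1.
by apply/order_leE; exists a.
Qed.

Lemma order_ltS p A : A \in order_lt p.+1 -> exists a, A - homop p a \in order_lt p.
Proof.
case/order_ltP => a ->; exists a; rewrite big_ord_recr /= addrK.
by apply/order_ltP; exists a.
Qed.

Lemma order_lt_coef p a A : A - homop p a \in order_lt p ->
  exists b, A = \sum_(q < p.+1) homop q b /\
            forall i : mindex m p, term b i = term a i.
Proof.
(* Below weight [p] the coefficients are those of the remainder; from weight [p] on they are those
   of [a]. *)
case/order_ltP => b bE; exists (fun t => if (tag t < p)%N then b t else a t).
split; last by move=> i; rewrite /term /= ltnn.
rewrite big_ord_recr /=.
rewrite (_ : homop p _ = homop p a); last first.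
  by apply: eq_homop => i; rewrite /term /= ltnn.
rewrite -[LHS](subrK (homop p a)) bE; congr (_ + _); apply: eq_bigr => q _.
by apply: eq_homop => i; rewrite /term /= ltn_ord.
Qed.

Lemma order_ltSK p a A : A - homop p a \in order_lt p -> A \in order_lt p.+1.
Proof. by case/order_lt_coef => b [-> _]; apply/order_ltP; exists b. Qed.

Lemma homop_order_lt p a : homop p a \in order_lt p.+1.
Proof. by apply: (@order_ltSK p a); rewrite subrr rpred0. Qed.

Lemma order_ltW p q A : (p <= q)%N -> A \in order_lt p -> A \in order_lt q.
Proof.
move=> /subnKC <- Ap; elim: (q - p)%N => [|d IHd]; first by rewrite addn0.
by rewrite addnS; apply: (@order_ltSK _ 0); rewrite linear0 subr0.
Qed.

Lemma monom_homop f e : exists a, monom f e = homop (\sum_j e j)%N a.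
Proof.
set p := (\sum_j e j)%N.
have ep j : (e j < p.+1)%N by rewrite ltnS /p (bigD1 j)//= leq_addr.
pose i : {ffun 'I_m -> 'I_p.+1} := [ffun j => inord (e j)].
have iE j : i j = e j :> nat by rewrite ffunE inordK.
have ip : (\sum_j i j)%N == p by apply/eqP/eq_bigr => j _; rewrite iE.
pose i0 : mindex m p := exist _ i ip.
exists (fun t => if t == Tagged (mindex m) i0 then f else 0).
apply: diffop_ext => phi; rewrite homopE (bigD1 i0)//= big1 ?addr0 => [|k kN].
  rewrite /term eqxx /monomial; congr (_ * _); apply: eq_bigr => j _.
  by rewrite -iE.
by rewrite /term eq_Tagged /= (negbTE kN) mul0r.
Qed.

Lemma monom_order_lt p f e : (\sum_j e j < p)%N -> monom f e \in order_lt p.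
Proof.
by have [a ->] := monom_homop f e => ep; apply: order_ltW (homop_order_lt _ _).
Qed.

Lemma cfun_sum (I : Type) (r : seq I) (P : pred I) (F : I -> Cinf R M) (x : R) :
  (\sum_(i <- r | P i) F i) x = \sum_(i <- r | P i) F i x.
Proof. by elim/big_rec2: _ => // i y A _ <-. Qed.

Lemma cfun_prod (I : Type) (r : seq I) (P : pred I) (F : I -> Cinf R M) (x : R) :
  (\prod_(i <- r | P i) F i) x = \prod_(i <- r | P i) F i x.
Proof. by elim/big_rec2: _ => // i y A _ <-. Qed.

Lemma cderXS f n : cder (f ^+ n.+1) = n.+1%:R * (cder f * f ^+ n).
Proof.
elim: n => [|n IHn]; first by rewrite expr1 expr0 mul1r mulr1.
by rewrite exprS cderM IHn exprS -[n.+2%:R]natr1; ring.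
Qed.

(** By induction on [n], the n-th derivative of t^k is t^(k - n) times a function whose value at
    [x0] is k (k - 1) ... (k - n + 1). The power of [t] vanishes at [x0] unless n = k. *)
Lemma iter_cder_exp (x0 : R) (t : Cinf R M) n k : t x0 = 0 -> cder t x0 = 1 ->
  (n <= k)%N -> iter n (@cder R M) (t ^+ k) x0 = (if n == k then k`!%:R else 0).
Proof.
move=> t0 t1 nk.
have [g gE gx0] : exists2 g : Cinf R M,
    iter n (@cder R M) (t ^+ k) = t ^+ (k - n) * g & g x0 = (k ^_ n)%:R.
  elim: n nk => [|n IHn] nk; first by exists 1; rewrite ?subn0 ?mulr1.
  have [g gE gx0] := IHn (ltnW nk).
  (* This is the cofactor left by the product rule once t^(k - n - 1) is factored out. *)
  exists ((k - n)%:R * (cder t * g) + t * cder g).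
    rewrite iterS gE -[(k - n)%N]prednK ?subn_gt0// -subnS.
    by rewrite cderM cderXS [t ^+ _.+1]exprS; ring.
  rewrite -[(k - n)%:R](rmorph_nat (cconst M)).
  change ((k - n)%:R * 1 * (cder t x0 * g x0) + t x0 * cder g x0 = (k ^_ n.+1)%:R :> R).
  by rewrite t0 t1 gx0 ffactnSr natrM; ring.
rewrite gE -[LHS]/((t ^+ (k - n)) x0 * g x0) gx0.
have [->|nNk] := eqVneq; first by rewrite subnn ffactnn -[LHS]/(1 * _) mul1r.
have : (0 < k - n)%N by rewrite subn_gt0 ltn_neqAle nNk.
case: (k - n)%N => // d _; rewrite exprS.
change (t x0 * (t ^+ d) x0 * (k ^_ n)%:R = 0 :> R).
by rewrite t0 !mul0r.
Qed.

(** When the weight of [i] does not exceed that of [s] and [i] differs from [s], some entry of [i]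
    is smaller than that of [s], and the corresponding factor vanishes at [x0]. *)
Lemma partial_exp (x0 : R) (t : Cinf R M) p q (i : mindex m q) (s : mindex m p) :
  t x0 = 0 -> cder t x0 = 1 -> (q <= p)%N ->
  partial i (fun j => t ^+ val s j) x0 =
  if [forall j, val i j == val s j :> nat] then \prod_j (val s j)`!%:R else 0.
Proof.
move=> t0 t1 qp; rewrite /partial cfun_prod; case: ifPn => [/forallP is_|].
  apply: eq_bigr => j _; rewrite (eqP (is_ j)) iter_cder_exp ?eqxx//.
have [/forallP si|] := boolP [forall j, (val s j <= val i j)%N].
  have leS := leqif_sum (fun j (_ : true) => leqif_eq (si j)).
  have is_ : (\sum_j val i j <= \sum_j val s j)%N.
    by rewrite (eqP (valP i)) (eqP (valP s)).
  case/negP; apply/forallP => j; rewrite eq_sym.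
  have /esym := leS.2; rewrite eqn_leq leS.1 is_ /= => /forallP/(_ j).
  by [].
rewrite negb_forall => /existsP[j]; rewrite -ltnNge => ij _.
rewrite (bigD1 j)//= iter_cder_exp ?(ltnW ij)// ltn_eqF//.
by rewrite mul0r.
Qed.

(** Evaluate at [x0] on the powers of a local coordinate with exponents [s]: every operator of order
    below [p] gives 0, while [homop p a] gives the coefficient of index [s] at [x0] times a product
    of factorials. *)
Lemma homop_inj p a : homop p a \in order_lt p ->
  forall i : mindex m p, term a i = 0.
Proof.
case/order_ltP => b aE s; apply/val_inj/funext => x0.
have [t [t0 t1]] := local_coordinate_exists M x0.
have : oper_of (homop p a) (fun j => t ^+ val s j) x0 =
       oper_of (\sum_(q < p) homop q b) (fun j => t ^+ val s j) x0 by rewrite aE.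
rewrite [in RHS]diffop_val_sum homopE !cfun_sum [RHS]big1 => [|q _]; last first.
  rewrite homopE cfun_sum big1// => i _.
  rewrite -[LHS]/(term b i x0 * partial i _ x0) partial_exp ?(ltnW (ltn_ord q))//.
  case: ifPn => [/forallP is_|_]; last by rewrite mulr0.
  suff pq : p = q by exfalso; have := ltn_ord q; rewrite -pq ltnn.
  apply: etrans (etrans _ (eqP (valP i))); first exact/esym/(eqP (valP s)).
  by apply: eq_bigr => j _; rewrite (eqP (is_ j)).
rewrite (bigD1 s)//= big1 ?addr0 => [|i iNs]; last first.
  rewrite -[LHS]/(term a i x0 * partial i _ x0) partial_exp//.
  case: ifPn => [/forallP is_|_]; last by rewrite mulr0.
  case/eqP: iNs; apply/val_inj/ffunP => j; apply/val_inj; exact: (eqP (is_ j)).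
rewrite -[LHS]/(term a s x0 * partial s _ x0) partial_exp//.
case: ifPn => [_|/forallP[j]]; last by [].
move=> /eqP; rewrite mulf_eq0 => /orP[/eqP//|/eqP].
move=> /eqP; rewrite prodf_seq_eq0 => /hasP[j _].
by rewrite /= pnatr_eq0 eqn0Ngt fact_gt0.
Qed.

End Filtration.

(** * The action on operators and its effect on leading parts *)

Section Action.
Variables (R : realType) (M : manifold) (m : nat).
Variables (lambda : 'I_m -> R) (mu : R).
Implicit Types (A B : diffop R M m) (a b : family_of R M m) (f g X Y : Cinf R M).
Implicit Types (phi : 'I_m -> Cinf R M) (e : 'I_m -> nat) (p q : nat).

Local Notation L := (diffop_act lambda mu).
Local Notation delta := (weight_shift lambda mu).

Lemma diffop_actE X A phi : oper_of (L X A) phi =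
  dens_act mu X (oper_of A phi) -
  \sum_j oper_of A (subst_arg j (dens_act (lambda j) X) phi).
Proof. by []. Qed.

Lemma iter_cder_lin n (c : R) f g :
  iter n (@cder R M) (c *: f + g) =
  c *: iter n (@cder R M) f + iter n (@cder R M) g.
Proof. by elim: n => //= n ->; rewrite cderD cderZ. Qed.

(** The relation between [F], [G] and [H] is only required at [phi j]; this serves both for
    linearity of the action in the field and for commutators in one argument. *)
Lemma diffop_multilinear A j (c : R) (F G H : Cinf R M -> Cinf R M) phi :
  H (phi j) = c *: F (phi j) + G (phi j) ->
  oper_of A (subst_arg j H phi) =
  c *: oper_of A (subst_arg j F phi) + oper_of A (subst_arg j G phi).
Proof.
move=> HE; case: A => A /= DA; move: A DA.
apply: (diffop_ind (P := fun A : oper R M m =>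
  A (subst_arg j H phi) =
  c *: A (subst_arg j F phi) + A (subst_arg j G phi))) => [|A B AE BE|f e].
- by rewrite scaler0 addr0.
- by rewrite !operE AE BE scalerDr addrACA.
rewrite /monomial !(bigD1 j (P := predT))//= /subst_arg !eqxx HE iter_cder_lin.
rewrite (eq_bigr (fun l => iter (e l) (@cder R M) (phi l))); last first.
  by move=> l /negbTE ->.
rewrite [in X in c *: (f * (_ * X))](eq_bigr (fun l => iter (e l) (@cder R M) (phi l))); last first.
  by move=> l /negbTE ->.
rewrite [in X in _ + (f * (_ * X))](eq_bigr (fun l => iter (e l) (@cder R M) (phi l))); last first.
  by move=> l /negbTE ->.
by rewrite !cscaleE; ring.
Qed.

Lemma diffop_linE (c : R) A B phi :
  oper_of (c *: A + B) phi = c *: oper_of A phi + oper_of B phi.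
Proof. by []. Qed.

Lemma diffop_act_linear X : linear (L X).
Proof.
move=> c A B; apply: diffop_ext => phi.
rewrite diffop_linE !diffop_actE diffop_linE linearP.
under eq_bigr do rewrite diffop_linE.
by rewrite big_split /= -scaler_sumr scalerBr opprD addrACA.
Qed.

HB.instance Definition _ X := GRing.isLinear.Build R (diffop R M m)
  (diffop R M m) _ (L X) (diffop_act_linear X).

Lemma diffop_act_lin (c : R) X Y A : L (c *: X + Y) A = c *: L X A + L Y A.
Proof.
apply: diffop_ext => phi.
rewrite diffop_linE !diffop_actE.
rewrite dens_act_lin scalerBr addrACA scaler_sumr -opprD -big_split /=; congr (_ - _).
by apply: eq_bigr => j _; apply: diffop_multilinear; rewrite dens_act_lin.
Qed.

Lemma subst_argC i j (F G : Cinf R M -> Cinf R M) phi : i != j ->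
  subst_arg i F (subst_arg j G phi) = subst_arg j G (subst_arg i F phi).
Proof.
move=> ij; apply/funext => l; rewrite /subst_arg.
by have [->|//] := eqVneq l i; rewrite (negbTE ij).
Qed.

(** In the commutator, the terms acting once on the value and once on an argument are symmetric in
    [X] and [Y] and cancel. So do those acting on two different arguments. There remain the
    commutators on the value and on each single argument, given by [dens_act_bracket]. *)
Lemma diffop_act_bracket X Y A : L (bracket X Y) A = L X (L Y A) - L Y (L X A).
Proof.
apply: diffop_ext => phi.
rewrite -[RHS]/(oper_of (L X (L Y A)) phi - oper_of (L Y (L X A)) phi).
pose D X i Y j := oper_of A (subst_arg j (dens_act (lambda j) Y)
  (subst_arg i (dens_act (lambda i) X) phi)).
pose E X Y := \sum_j dens_act mu X (oper_of A (subst_arg j (dens_act (lambda j) Y) phi)).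
have actE X' Y' : oper_of (L X' (L Y' A)) phi =
    dens_act mu X' (dens_act mu Y' (oper_of A phi)) - (E X' Y' + E Y' X')
    + \sum_i \sum_j D X' i Y' j.
  rewrite diffop_actE (eq_bigr (fun i => dens_act mu Y'
    (oper_of A (subst_arg i (dens_act (lambda i) X') phi)) - \sum_j D X' i Y' j)); last first.
    by move=> i _; rewrite diffop_actE.
  by rewrite sumrB diffop_actE linearB linear_sum /= -/(E X' Y') -/(E Y' X'); ring.
rewrite (actE X Y) (actE Y X) diffop_actE dens_act_bracket.
(* Successive substitutions compose in the reverse order, whence the exchange of [X] and [Y]
   here. *)
suff -> : \sum_j oper_of A (subst_arg j (dens_act (lambda j) (bracket X Y)) phi) =
    \sum_i \sum_j D Y i X j - \sum_i \sum_j D X i Y j by ring.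
rewrite [X in _ = X - _]exchange_big /= -sumrB; apply: eq_bigr => j _.
rewrite -sumrB (bigD1 j)//= big1 ?addr0 => [|i ij]; last first.
  by rewrite /D subst_argC 1?eq_sym// subrr.
rewrite /D; have subst2 F G : subst_arg j F (subst_arg j G phi) = subst_arg j (F \o G) phi.
  by apply/funext => l; rewrite /subst_arg; case: eqP.
rewrite !subst2 (diffop_multilinear _ (c := -1)
  (F := dens_act (lambda j) Y \o dens_act (lambda j) X)
  (G := dens_act (lambda j) X \o dens_act (lambda j) Y)).
  by rewrite scaleN1r addrC.
by rewrite dens_act_bracket scaleN1r addrC.
Qed.

(** The Leibniz rule with its terms of order n + 1 and n made explicit. The list [s] of coefficients
    and orders is chosen before [f], so the remainder is a genuine differential operator of order
    below [n]. *)
Lemma iter_cder_dens_act (c : R) X n : exists2 s : seq (Cinf R M * nat),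
  all (fun t => t.2 < n)%N s & forall f,
  iter n (@cder R M) (dens_act c X f) =
  X * iter n.+1 (@cder R M) f + cconst M (n%:R + c) * (cder X * iter n (@cder R M) f)
  + \sum_(t <- s) t.1 * iter t.2 (@cder R M) f.
Proof.
elim: n => [|n [s sn IHs]].
  exists [::] => // f; rewrite big_nil /= dens_actE add0r; ring.
exists ((cconst M (n%:R + c) * cder (cder X), n) ::
  flatten [seq [:: (cder t.1, t.2); (t.1, t.2.+1)] | t <- s]).
  rewrite /= ltnSn /=; elim: s sn {IHs} => //= t s IHs /andP[tn sn].
  by rewrite IHs// (ltn_trans tn)// ltnS tn.
move=> f; rewrite iterS IHs !(cderD, cderM, cder_cconst) big_cons /=.
set S := \sum_(j <- flatten _) _.
have -> : cder (\sum_(t <- s) t.1 * iter t.2 (@cder R M) f) = S.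
  rewrite {}/S; elim: s {sn IHs} => [|t s IHs]; first by rewrite !big_nil cder0.
  by rewrite /= !big_cons cderD cderM IHs addrA.
rewrite -[n.+1%:R]natr1; ring.
Qed.

(** The terms of order |e| + 1 coming from the value and from the arguments cancel, both being f X
    times the derivative of the product. In order |e| the coefficient of f X' is mu minus the sum of
    the e_j + lambda_j, that is delta - |e|. *)
Lemma diffop_act_monom X f e :
  L X (monom f e) - monom (dens_act (delta - (\sum_j e j)%:R) X f) e
    \in order_lt (\sum_j e j)%N.
Proof.
have /choice[s sP] : forall j, exists s : seq (Cinf R M * nat),
    all (fun t => t.2 < e j)%N s /\ forall f,
    iter (e j) (@cder R M) (dens_act (lambda j) X f) =
    X * iter (e j).+1 (@cder R M) f
    + cconst M ((e j)%:R + lambda j) * (cder X * iter (e j) (@cder R M) f)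
    + \sum_(t <- s) t.1 * iter t.2 (@cder R M) f.
  by move=> j; have [s] := iter_cder_dens_act (lambda j) X (e j); exists s.
rewrite (_ : _ - _ = - \sum_j \sum_(t <- s j)
    monom (f * t.1) (fun l => if l == j then t.2 else e l)).
  rewrite rpredN rpred_sum// => j _; have [sj _] := sP j.
  rewrite big_seq rpred_sum// => t ts; apply: monom_order_lt.
  rewrite (bigD1 j)//= eqxx [X in (_ < X)%N](bigD1 j)//=.
  rewrite (eq_bigr e) => [|l /negbTE->//].
  by rewrite ltn_add2r (allP sj).
apply: diffop_ext => phi.
rewrite -[LHS]/(oper_of (L X (monom f e)) phi - oper_of (monom _ e) phi) diffop_actE.
rewrite -[RHS]/(- (oper_of _ phi)) diffop_val_sum.
pose P := \prod_j iter (e j) (@cder R M) (phi j).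
pose P' j := \prod_(l | l != j) iter (e l) (@cder R M) (phi l).
have PE j : P = iter (e j) (@cder R M) (phi j) * P' j by rewrite /P (bigD1 j).
have PsE j F : \prod_l iter (e l) (@cder R M) (subst_arg j F phi l) =
    iter (e j) (@cder R M) (F (phi j)) * P' j.
  rewrite (bigD1 j)//= /subst_arg eqxx; congr (_ * _).
  by apply: eq_bigr => l /negbTE->.
have PtE j n : \prod_l iter (if l == j then n else e l) (@cder R M) (phi l) =
    iter n (@cder R M) (phi j) * P' j.
  rewrite (bigD1 j)//= eqxx; congr (_ * _).
  by apply: eq_bigr => l /negbTE->.
have cderP : cder P = \sum_j iter (e j).+1 (@cder R M) (phi j) * P' j.
  rewrite /P cder_prod ?index_enum_uniq//; apply: eq_bigr => j _.
  by rewrite (bigD1 j)//= eqxx; congr (_ * _); apply: eq_bigr => l /negbTE->.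
have sE j : oper_of (monom f e) (subst_arg j (dens_act (lambda j) X) phi) =
    f * X * (iter (e j).+1 (@cder R M) (phi j) * P' j)
    + cconst M ((e j)%:R + lambda j) * (f * cder X * P)
    + oper_of (\sum_(t <- s j) monom (f * t.1) (fun l => if l == j then t.2 else e l)) phi.
  rewrite diffop_val_sum /= /monomial PsE (sP j).2 (PE j).
  under [X in _ = _ + X]eq_bigr do rewrite PtE mulrA -[f * _ * _]mulrA.
  by rewrite -mulr_suml -mulr_sumr /=; ring.
rewrite (eq_bigr _ (fun j _ => sE j)) !big_split /= -mulr_sumr -cderP -mulr_suml -rmorph_sum.
rewrite big_split /= -natr_sum /monomial -/P !dens_actE /weight_shift cderM.
rewrite !(rmorphB, rmorphD) /=.
(* The sums over [j] are generalized to variables, leaving a plain ring identity. *)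
have ringE E La S : X * (cder f * P + f * cder P) + cconst M mu * (f * P * cder X) -
    (f * X * cder P + (E + La) * (f * cder X * P) + S) -
    (X * cder f + (cconst M mu - La - E) * (f * cder X)) * P = - S by ring.
exact: ringE.
Qed.

Lemma diffop_act_homop p X a :
  L X (homop p a) - homop p (family_act delta X a) \in order_lt p.
Proof.
rewrite linear_sum /= -sumrB rpred_sum// => i _.
by have := diffop_act_monom X (term a i) (fun j => val i j); rewrite (eqP (valP i)).
Qed.

Lemma diffop_act_order_lt p X A : A \in order_lt p -> L X A \in order_lt p.
Proof.
case/order_ltP => a ->; rewrite linear_sum rpred_sum// => q _.
apply: (@order_ltW _ _ _ q.+1) => //.
exact: (order_ltSK (diffop_act_homop _ _ _)).
Qed.

End Action.

(** * Principal symbols in all degrees at once *)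

Section PrincipalSymbol.
Variables (R : realType) (M : manifold) (m : nat).
Implicit Types (alpha beta : forall p, 'M[R]_#|{: mindex m p}|).
Implicit Types (a b : family_of R M m) (X : Cinf R M).

(** As an endomorphism of families, the principal symbol can be inverted degree by degree and
    composed with quantization. *)
Definition mix alpha a : family_of R M m :=
  fun t => principal_symbol alpha a (tagged t).

Lemma term_mix alpha a p (i : mindex m p) :
  term (mix alpha a) i = principal_symbol alpha a i.
Proof. by []. Qed.

Lemma family_ext a b : (forall p (i : mindex m p), term a i = term b i) -> a = b.
Proof. by move=> ab; apply/funext => -[p i]; exact: ab. Qed.

Lemma mix_linear alpha : linear (mix alpha).
Proof.
move=> c a b; apply: family_ext => p i.
rewrite -[RHS]/(c *: principal_symbol alpha a i + principal_symbol alpha b i).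
rewrite term_mix /principal_symbol scaler_sumr -big_split; apply: eq_bigr => s _.
by rewrite -[term _ s]/(c *: term a s + term b s) scalerDr !scalerA mulrC.
Qed.

HB.instance Definition _ alpha := GRing.isLinear.Build R (family_of R M m)
  (family_of R M m) _ (mix alpha) (mix_linear alpha).

Lemma eq_principal_symbol alpha a b p :
  (forall i : mindex m p, term a i = term b i) ->
  forall i : mindex m p, principal_symbol alpha a i = principal_symbol alpha b i.
Proof. by move=> ab i; apply: eq_bigr => s _; rewrite ab. Qed.

Lemma mixK alpha beta : (forall p, beta p *m alpha p = 1%:M) ->
  cancel (mix alpha) (mix beta).
Proof.
move=> ba a; apply: family_ext => p i; rewrite term_mix /principal_symbol.
transitivity (\sum_(u : mindex m p)
    (beta p *m alpha p) (enum_rank i) (enum_rank u) *: term a u).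
  under [RHS]eq_bigr => u _.
    rewrite mxE (reindex enum_rank) /=; last exact/onW_bij/enum_rank_bij.
    rewrite scaler_suml.
    over.
  rewrite exchange_big; apply: eq_bigr => s _; rewrite /= term_mix scaler_sumr.
  by apply: eq_bigr => u _; rewrite scalerA.
rewrite ba (bigD1 i)//= mxE eqxx scale1r big1 ?addr0// => u ui.
by rewrite mxE (inj_eq enum_rank_inj) eq_sym (negbTE ui) scale0r.
Qed.

(** The entries of [alpha p] are constants, and all the copies that they mix carry the same density
    weight delta - p. *)
Lemma family_act_mix alpha delta X a :
  family_act delta X (mix alpha a) = mix alpha (family_act delta X a).
Proof.
apply: family_ext => p i; rewrite term_mix /principal_symbol.
rewrite -[LHS]/(dens_act (delta - p%:R) X (principal_symbol alpha a i)).
by rewrite linear_sum; apply: eq_bigr => s _; rewrite linearZ.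
Qed.

End PrincipalSymbol.

(** * The Casimir operator and its spectral projections *)

Lemma casimir_comm (V : zmodType) (L0 L1 L2 : {additive V -> V}) :
  (forall v, L0 (L1 v) = L1 (L0 v) + L0 v) ->
  (forall v, L0 (L2 v) = L2 (L0 v) + L1 v *+ 2) ->
  (forall v, L1 (L2 v) = L2 (L1 v) + L2 v) ->
  let C v := L1 (L1 v) - L1 v - L2 (L0 v) in
  forall v, [/\ C (L0 v) = L0 (C v), C (L1 v) = L1 (C v) & C (L2 v) = L2 (C v)].
Proof.
move=> L01 L02 L12 C v; rewrite /C !raddfB.
(* The common shape of the cases [L0] and [L2]: the corrections [b] and [d], created by reordering
   with the commutation relations, cancel. *)
have cancel_add a b d e : a + b + (b + d) - (b + d) - (e + (b + b)) = a - b - e :> V.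
  by rewrite addrK [e + _]addrC -[b + b + e]addrA opprD addrA addrK opprD addrA.
split.
- by rewrite L02 mulr2n !L01 raddfD cancel_add.
- by rewrite L01 L12 raddfD.
- by rewrite L02 mulr2n !L12 (raddfD L1) !(raddfD L2) !L12 cancel_add.
Qed.

Section Casimir.
Variables (R : realType) (M : manifold) (m : nat).
Variables (lambda : 'I_m -> R) (mu : R).
Variables (X0 X1 X2 : Cinf R M) (tri : sl2_triple X0 X1 X2).
Implicit Types (A B : diffop R M m) (a : family_of R M m) (X : Cinf R M).
Implicit Types (p q n : nat).

Local Notation L := (diffop_act lambda mu).
Local Notation delta := (weight_shift lambda mu).
Local Notation act := (family_act delta).

(** By [X0, X2] = 2 X1, this is the symmetric Casimir element X1^2 - (X0 X2 + X2 X0) / 2 in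
    reordered form. *)
Definition casimir A : diffop R M m := L X1 (L X1 A) - L X1 A - L X2 (L X0 A).

(* The scalar by which the Casimir operator acts on F_(delta - p). *)
Definition eigenvalue p : R := (delta - p%:R) * (delta - p%:R - 1).

Local Notation c := eigenvalue.

Lemma casimir_linear : linear casimir.
Proof.
move=> k A B; rewrite /casimir !linearP /= !scalerDr.
by rewrite [X in X + _ = _]addrACA [LHS]addrACA.
Qed.

HB.instance Definition _ := GRing.isLinear.Build R (diffop R M m)
  (diffop R M m) _ casimir casimir_linear.

Lemma casimir_act X A : in_sl2 X -> casimir (L X A) = L X (casimir A).
Proof.
case: tri => _ _ _ span b01 b02 b12 _ _ _ _.
have L01 B : L X0 (L X1 B) = L X1 (L X0 B) + L X0 B.
  have := diffop_act_bracket lambda mu X0 X1 B.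
  by rewrite b01 => E; rewrite [X in _ = _ + X]E [RHS]addrC subrK.
have L02 B : L X0 (L X2 B) = L X2 (L X0 B) + L X1 B *+ 2.
  have -> : L X1 B *+ 2 = L (bracket X0 X2) B.
    by rewrite b02 !mulr2n -[X in L (X + _)]scale1r diffop_act_lin scale1r.
  by rewrite diffop_act_bracket [RHS]addrC subrK.
have L12 B : L X1 (L X2 B) = L X2 (L X1 B) + L X2 B.
  have := diffop_act_bracket lambda mu X1 X2 B.
  by rewrite b12 => E; rewrite [X in _ = _ + X]E [RHS]addrC subrK.
have [C0 C1 C2] := casimir_comm (L0 := L X0) (L1 := L X1) (L2 := L X2) L01 L02 L12 A.
rewrite -[_ = L X0 _]/(casimir (L X0 A) = L X0 (casimir A)) in C0.
rewrite -[_ = L X1 _]/(casimir (L X1 A) = L X1 (casimir A)) in C1.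
rewrite -[_ = L X2 _]/(casimir (L X2 A) = L X2 (casimir A)) in C2.
have L0 B : L 0 B = 0.
  apply: (addrI (L 0 B)).
  by rewrite addr0 -[X in X + _]scale1r -diffop_act_lin scaler0 addr0.
have C0' : casimir 0 = 0 by exact: linear0.
(* The added zero gives all three summands the form to which [diffop_act_lin] applies. *)
case/span => x [y [z ->]]; rewrite -[z *: X2]addr0 !diffop_act_lin !L0.
by rewrite !casimir_linear C0 C1 C2 C0'.
Qed.

Lemma family_casimir a :
  act X1 (act X1 a) - act X1 a - act X2 (act X0 a) =
  (fun t => c (tag t) *: a t) :> family_of R M m.
Proof.
by apply/funext => t; rewrite -(dens_casimir (delta - (tag t)%:R) (a t) tri).
Qed.

Lemma act_top X p a A : A - homop p a \in order_lt p ->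
  L X A - homop p (act X a) \in order_lt p.
Proof.
move=> Aa; rewrite -[L X A](subrK (L X (homop p a))) -addrA -linearB /=.
by rewrite rpredD ?diffop_act_homop ?diffop_act_order_lt.
Qed.

(** Up to lower order, the action on leading parts is that on densities of weight delta - p, where
    the Casimir operator is the scalar [c p]. *)
Lemma casimir_top p a A : A - homop p a \in order_lt p ->
  casimir A - c p *: A \in order_lt p.
Proof.
move=> Aa.
have CA : casimir A - c p *: homop p a \in order_lt p.
  have -> : c p *: homop p a =
      homop p (act X1 (act X1 a)) - homop p (act X1 a) - homop p (act X2 (act X0 a)).
    by rewrite -!linearB -linearZ /= family_casimir; apply: eq_homop.
  rewrite /casimir !opprD !opprK addrACA rpredD//; last first.
    by rewrite addrC -opprB rpredN; do 2 apply: act_top.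
  rewrite addrACA rpredD//; first by do 2 apply: act_top.
  by rewrite addrC -opprB rpredN; apply: act_top.
rewrite -[casimir A](subrK (c p *: homop p a)) -addrA -scalerBr rpredD//.
by rewrite rpredZ// -opprB rpredN.
Qed.

(* The product of the [(casimir - c q) / (c p - c q)] for [q < n]: for [n = p],
   it is the projection of [D^p] onto the eigenspace of [c p]. *)
Fixpoint eigenproj p n A : diffop R M m :=
  if n is q.+1 then eigenproj p q ((c p - c q)^-1 *: (casimir A - c q *: A)) else A.

Lemma eigenproj_linear p n : linear (eigenproj p n).
Proof.
elim: n => //= n IHn k A B; rewrite -IHn; congr eigenproj.
rewrite casimir_linear; set r := _^-1.
rewrite [k *: (r *: _)]scalerA [k * r]mulrC -[(r * k) *: _]scalerA -scalerDr; congr (_ *: _).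
rewrite [c n *: (_ + _)]scalerDr opprD addrACA [in RHS]scalerBr.
by rewrite [c n *: _]scalerA [c n * k]mulrC -[(k * c n) *: _]scalerA.
Qed.

HB.instance Definition _ p n := GRing.isLinear.Build R (diffop R M m)
  (diffop R M m) _ (eigenproj p n) (eigenproj_linear p n).

(** The factor with the largest [q] is applied first. By [casimir_top], each factor lowers the order
    of what remains by one, so nothing is left after [n] of them. *)
Lemma eigenproj_order_lt p n A : A \in order_lt n -> eigenproj p n A = 0.
Proof.
elim: n A => [|n IHn] A; first exact: order_lt0.
by case/order_ltS => a /casimir_top An; rewrite /= IHn// rpredZ.
Qed.

Lemma eigenproj_comm (f : {linear diffop R M m -> diffop R M m}) p n A :
  (forall B, casimir (f B) = f (casimir B)) ->
  eigenproj p n (f A) = f (eigenproj p n A).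
Proof.
move=> Cf; elim: n A => //= n IHn A; rewrite -IHn; congr eigenproj.
have fE r k U W : f (r *: (U - k *: W)) = r *: (f U - k *: f W).
  by rewrite linearZ linearB linearZ.
by rewrite fE Cf.
Qed.

(** On leading parts of order [p] the Casimir operator is [c p], so each normalized factor acts
    there as the identity. *)
Lemma eigenproj_top p n a A : (n <= p)%N ->
  (forall q, (q < p)%N -> c q != c p) ->
  A - homop p a \in order_lt p -> eigenproj p n A - homop p a \in order_lt p.
Proof.
move=> np cq; elim: n A np => //= n IHn A np Aa; apply: IHn; first exact: ltnW.
have cn : c p - c n != 0 by rewrite subr_eq0 eq_sym cq.
have -> : casimir A - c n *: A = casimir A - c p *: A + (c p - c n) *: A.
  by rewrite scalerBl addrA subrK.
rewrite scalerDr scalerA mulVf// scale1r -addrA rpredD// rpredZ//.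
exact: casimir_top Aa.
Qed.

(** The projection commutes with [casimir] and kills [casimir - c p] applied to [homop p a], which
    has order below [p]. *)
Lemma casimir_eigenproj p a :
  casimir (eigenproj p p (homop p a)) = c p *: eigenproj p p (homop p a).
Proof.
apply/eqP; rewrite -subr_eq0 -(eigenproj_comm (f := casimir))// -linearZ -linearB.
apply/eqP/eigenproj_order_lt/(@casimir_top _ a).
by rewrite subrr rpred0.
Qed.

(** The action commutes with the projection, and its defect of homogeneity on [homop p a] has order
    below [p], hence is killed. *)
Lemma eigenproj_act p X a : in_sl2 X ->
  L X (eigenproj p p (homop p a)) = eigenproj p p (homop p (act X a)).
Proof.
move=> sX; rewrite -(eigenproj_comm (f := L X)) => [|B]; last exact: casimir_act.
by apply/eqP; rewrite -subr_eq0 -linearB; apply/eqP/eigenproj_order_lt/diffop_act_homop.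
Qed.

End Casimir.

(** * Quantization, existence and uniqueness of the symbol map *)

Lemma inverse_linear (R : nzRingType) (U V : lmodType R) (f : U -> V) (g : V -> U) :
  cancel f g -> cancel g f -> linear f -> linear g.
Proof.
move=> fK gK lf c u v; apply: (can_inj fK).
by rewrite lf !gK.
Qed.

Section SymbolMap.
Variables (R : realType) (M : manifold) (m : nat).
Variables (lambda : 'I_m -> R) (mu : R).
Variables (X0 X1 X2 : Cinf R M) (tri : sl2_triple X0 X1 X2).
Variable (alpha : forall p, 'M[R]_#|{: mindex m p}|).
Hypothesis (alpha_unit : forall p, alpha p \in unitmx).
(* The orders on which equivariance is imposed: those [<= k], or all of them. *)
Variable (b : pred nat).
Implicit Types (A B : diffop R M m) (a w : family_of R M m) (X : Cinf R M).
Implicit Types (p q n N : nat) (s : symbol R M m).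

Local Notation L := (diffop_act lambda mu).
Local Notation delta := (weight_shift lambda mu).
Local Notation act := (family_act delta).
Local Notation c := (eigenvalue lambda mu).
Local Notation casimir := (casimir lambda mu X0 X1 X2).
Local Notation eigenproj := (eigenproj lambda mu X0 X1 X2).
Local Notation beta := (fun p => invmx (alpha p)).

Hypothesis b_down : forall p q, b p -> (q < p)%N -> b q.
Hypothesis b_sep : forall p q, b p -> (q < p)%N -> c q != c p.

(* The quantization map, inverse to the symbol map, on symbols of degree [p]. *)
Definition quant1 p a : diffop R M m :=
  if b p then eigenproj p p (homop p a) else homop p a.

Lemma quant1_linear p : linear (quant1 p).
Proof. by move=> k u v; rewrite /quant1 !linearP /=; case: (b p). Qed.

HB.instance Definition _ p := GRing.isLinear.Build R (family_of R M m)
  (diffop R M m) _ (quant1 p) (quant1_linear p).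

Lemma eq_quant1 p a a' :
  (forall i : mindex m p, term a i = term a' i) -> quant1 p a = quant1 p a'.
Proof. by move=> aa'; rewrite /quant1 (eq_homop aa'). Qed.

(** Triangularity with respect to the order, from which the bijectivity of quantization follows. In
    degrees outside [b], where no equivariance is demanded, plain [homop] supplies it. *)
Lemma quant1_top p a : quant1 p a - homop p a \in order_lt p.
Proof.
rewrite /quant1; case: ifP => [bp|_]; last by rewrite subrr rpred0.
apply: (eigenproj_top tri) => // [q|]; first exact: b_sep.
by rewrite subrr rpred0.
Qed.

Lemma quant1_act p X a : b p -> in_sl2 X -> L X (quant1 p a) = quant1 p (act X a).
Proof. by rewrite /quant1 => -> sX; exact: eigenproj_act. Qed.

(** The inverse matrices [beta] ensure that the principal symbol taken with [alpha] gives back [w].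
    The cutoff [N] keeps the sum finite, and its choice does not matter above the degrees of [w],
    see [quant_widen]. *)
Definition quant N w : diffop R M m := \sum_(p < N) quant1 p (mix beta w).

Lemma quant_linear N : linear (quant N).
Proof.
move=> k u v; rewrite /quant scaler_sumr -big_split; apply: eq_bigr => p _.
by rewrite !linearP.
Qed.

HB.instance Definition _ N := GRing.isLinear.Build R (family_of R M m)
  (diffop R M m) _ (quant N) (quant_linear N).

Definition vanish N w := forall q (i : mindex m q), (N <= q)%N -> term w i = 0.

Lemma vanishW N N' w : (N <= N')%N -> vanish N w -> vanish N' w.
Proof. by move=> NN' wN q i Nq; apply: wN; exact: leq_trans Nq. Qed.

Lemma mix_term0 (alpha' : forall p, 'M[R]_#|{: mindex m p}|) p w :
  (forall i : mindex m p, term w i = 0) ->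
  forall i : mindex m p, term (mix alpha' w) i = 0.
Proof.
move=> w0 i; rewrite term_mix /principal_symbol big1// => s _.
by rewrite w0 scaler0.
Qed.

Lemma quant1_term0 p w : (forall i : mindex m p, term w i = 0) ->
  quant1 p (mix beta w) = 0.
Proof.
move=> w0; rewrite -[RHS](linear0 (quant1 p)); apply: eq_quant1 => i.
by rewrite mix_term0.
Qed.

Lemma quant_widen N N' w : (N <= N')%N -> vanish N w -> quant N' w = quant N w.
Proof.
move=> NN' wN; rewrite -(subnKC NN'); elim: (N' - N)%N => [|d IHd].
  by rewrite addn0.
rewrite addnS /quant big_ord_recr /= -/(quant _ _) IHd quant1_term0 ?addr0//.
by move=> i; apply: wN; exact: leq_addr.
Qed.

Lemma mix_betaK : cancel (mix (M := M) alpha) (mix beta).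
Proof. by apply: mixK => p; rewrite mulVmx. Qed.

Lemma mix_alphaK : cancel (mix (M := M) beta) (mix alpha).
Proof. by apply: mixK => p; rewrite mulmxV. Qed.

Lemma quant_order_lt N w : quant N w \in order_lt N.
Proof.
rewrite rpred_sum// => p _; apply: (@order_ltW _ _ _ p.+1); first exact: ltn_ord.
exact: order_ltSK (quant1_top _ _).
Qed.

Lemma quant_top N w :
  quant N.+1 w - homop N (mix beta w) \in order_lt N.
Proof.
rewrite /quant big_ord_recr /= -/(quant _ _) -addrA rpredD ?quant_order_lt//.
exact: quant1_top.
Qed.

(** If the image is zero, its leading part of order [N] has lower order, so the top component of [w]
    vanishes by [homop_inj]; then descend. *)
Lemma quant_inj N w : vanish N w -> quant N w = 0 -> w = 0.
Proof.
elim: N => [|N IHN] wN Qw0; first by apply: family_ext => p i; rewrite wN.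
have wN0 (i : mindex m N) : term w i = 0.
  rewrite -[w]mix_alphaK; apply: mix_term0; apply: homop_inj.
  by rewrite -rpredN -[X in X \in _]add0r -Qw0 quant_top.
have wN' : vanish N w.
  move=> q i; rewrite leq_eqVlt => /orP[/eqP Nq|]; last exact: wN.
  by case: q / Nq i.
by apply: IHN => //; rewrite -(quant_widen (leqnSn N)).
Qed.

Lemma quant_surj N A : A \in order_lt N -> exists2 w, vanish N w & A = quant N w.
Proof.
elim: N A => [|N IHN] A.
  by move/order_lt0 => ->; exists 0 => //; rewrite linear0.
case/order_ltS => a Aa.
(* The symbol of the leading part of [A], in degree [N] only; [alpha] compensates the [beta] in
   [quant]. *)
pose w0 : family_of R M m := fun t => if tag t == N then mix alpha a t else 0.
have w0E (i : mindex m N) : term w0 i = term (mix alpha a) i.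
  by rewrite /term /w0 /= eqxx.
have w0q q (i : mindex m q) : q != N -> term w0 i = 0.
  by rewrite /term /w0 /= => /negbTE ->.
have w0V : vanish N.+1 w0 by move=> q i Nq; rewrite w0q ?gtn_eqF.
have h0 : homop N (mix beta w0) = homop N a.
  rewrite -[in RHS](mix_betaK a); apply: eq_homop => i.
  exact: eq_principal_symbol.
have /IHN[w1 w1V AE] : A - quant N.+1 w0 \in order_lt N.
  rewrite -[A](subrK (homop N a)) -addrA rpredD// -opprB rpredN -h0.
  exact: quant_top.
exists (w1 + w0).
  move=> q i Nq; rewrite -[LHS]/(term w1 i + term w0 i) w0V// w1V ?addr0//.
  exact: ltnW.
by rewrite linearD /= (quant_widen (leqnSn N))// -AE subrK.
Qed.

Lemma quant_act N w X : (forall p, (p < N)%N -> b p) -> in_sl2 X ->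
  L X (quant N w) = quant N (act X w).
Proof.
move=> bN sX; rewrite /quant linear_sum /=; apply: eq_bigr => p _.
by rewrite quant1_act// ?bN// family_act_mix.
Qed.

(** A relation rather than a map, since the cutoff depends on the symbol. Both the symbol map and
    its inverse are choice functions for it. *)
Definition quant_rel A s := exists2 N, vanish N s & A = quant N s.

Lemma symbol_vanish s : exists N, vanish N s.
Proof. by have /fin_suppP[N sN] := valP s; exists N.+1. Qed.

Lemma quant_relE N A s : vanish N s -> quant_rel A s -> A = quant N s.
Proof.
move=> sN [N' sN' ->].
by rewrite -(quant_widen (leq_maxl N N') sN) -(quant_widen (leq_maxr N N') sN').
Qed.

Lemma quant_rel_order N A : A \in order_lt N ->
  exists2 s : symbol R M m, vanish N s & A = quant N s.
Proof.
case/quant_surj => w wN AE.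
have ws : w \in @fin_supp R M m.
  by apply/fin_suppP; exists N => q i Nq; apply: wN; exact: ltnW.
by exists (MkSymbol ws).
Qed.

Lemma quant_rel_inj A s s' : quant_rel A s -> quant_rel A s' -> s = s'.
Proof.
move=> [N sN AE] [N' sN' AE'].
have sK := vanishW (leq_maxl N N') sN; have sK' := vanishW (leq_maxr N N') sN'.
apply/val_inj/eqP; rewrite -subr_eq0 /=; apply/eqP/(@quant_inj (maxn N N')).
  move=> q i Nq; rewrite -[LHS]/(term s i - term s' i) sK// sK'// subrr//.
rewrite linearB /= (quant_widen (leq_maxl N N'))// (quant_widen (leq_maxr N N'))//.
by rewrite -AE -AE' subrr.
Qed.

(** Linearity is that of [quant] at a common cutoff, transferred to the inverse map. Equivariance on
    order [p] is [quant_act], since [b_down] puts all degrees up to [p] in [b]. *)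
Lemma symbol_map_exists : exists sigma : diffop R M m -> symbol R M m,
  symbol_map alpha sigma /\
  forall p, b p -> sl2_equivariant_on lambda mu (@order_le R M m p) sigma.
Proof.
have /choice[sigma sigmaE] : forall A, exists s, quant_rel A s.
  move=> A; have [N /quant_rel_order[s sN AE]] := order_lt_ex A.
  by exists s, N.
have /choice[tau tauE] : forall s, exists A, quant_rel A s.
  by move=> s; have [N sN] := symbol_vanish s; exists (quant N s), N.
have sK : cancel sigma tau.
  move=> A; have [N sN AE] := sigmaE A.
  by rewrite AE; apply: quant_relE => //; rewrite -AE.
have tK : cancel tau sigma by move=> s; exact: quant_rel_inj (tauE s).
exists sigma; split.
  split.
  - apply: (inverse_linear tK sK) => k s s'.
    have [N sN] := symbol_vanish s; have [N' sN'] := symbol_vanish s'.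
    have sK1 := vanishW (leq_maxl N N') sN.
    have sK2 := vanishW (leq_maxr N N') sN'.
    have sK3 : vanish (maxn N N') (k *: s + s').
      move=> q i Nq; rewrite -[LHS]/(k *: term s i + term s' i) sK1// sK2//.
      by rewrite scaler0 addr0.
    rewrite (quant_relE sK3 (tauE _)) (quant_relE sK1 (tauE _)).
    by rewrite (quant_relE sK2 (tauE _)) -linearP.
  - by exists tau.
  move=> p A /order_leE /quant_rel_order[s sp AE].
  have -> : sigma A = s by apply: (quant_rel_inj (sigmaE A)); exists p.+1.
  split; last by move=> q i pq; exact: sp.
  have [a [aE atop]] : exists a, A = \sum_(q < p.+1) homop q a /\
      forall i : mindex m p, term a i = term (mix beta s) i.
    by apply: order_lt_coef; rewrite AE quant_top.
  exists a => [|i]; first by rewrite op_of_coef_homop aE.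
  rewrite -[in LHS](mix_alphaK s) term_mix.
  by apply: eq_principal_symbol => j; rewrite atop.
move=> p bp X A sX /order_leE /quant_rel_order[s sp AE].
have -> : sigma A = s by apply: (quant_rel_inj (sigmaE A)); exists p.+1.
apply: (quant_rel_inj (sigmaE _)); exists p.+1.
  move=> q i pq; rewrite -[LHS]/(dens_act (delta - q%:R) X (term s i)) sp//.
  exact: linear0.
rewrite AE quant_act// => q; rewrite ltnS leq_eqVlt => /orP[/eqP->//|].
exact: b_down.
Qed.

(** The action preserves order at most [p], so equivariance can be used twice and turns [casimir]
    into its counterpart on symbols, which is scalar in each degree. *)
Lemma symbol_map_casimir p (sigma : diffop R M m -> symbol R M m) A :
  linear sigma -> sl2_equivariant_on lambda mu (@order_le R M m p) sigma ->
  A \in order_lt p.+1 ->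
  forall q (i : mindex m q), term (sigma (casimir A)) i = c q *: term (sigma A) i.
Proof.
move=> lin equiv Ap q i.
have actE X B : in_sl2 X -> B \in order_lt p.+1 ->
    terms (sigma (L X B)) = act X (sigma B).
  by move=> sX Bp; rewrite equiv//; exact/order_leE.
have [s0 s1 s2 _ _ _ _ _ _ _ _] := tri.
have LB X B : B \in order_lt p.+1 -> L X B \in order_lt p.+1.
  exact: diffop_act_order_lt.
have -> : sigma (casimir A) =
    sigma (L X1 (L X1 A)) - sigma (L X1 A) - sigma (L X2 (L X0 A)).
  have sB := GRing.zmod_morphism_linear lin.
  exact: etrans (sB _ _) (congr1 (fun t => t - _) (sB _ _)).
rewrite -[LHS]/((terms (sigma (L X1 (L X1 A))) - terms (sigma (L X1 A))
  - terms (sigma (L X2 (L X0 A)))) (Tagged (mindex m) i)).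
by rewrite !actE ?LB// (family_casimir lambda mu tri).
Qed.

(** Induction on the order: modulo lower order, [A] is an eigenvector [B] of the Casimir operator,
    whose image is forced in degree [N], above it and below it. *)
Lemma symbol_map_unique k (sigma sigma' : diffop R M m -> symbol R M m) :
  b k -> symbol_map alpha sigma -> symbol_map alpha sigma' ->
  sl2_equivariant_on lambda mu (@order_le R M m k) sigma ->
  sl2_equivariant_on lambda mu (@order_le R M m k) sigma' ->
  forall A, order_le k A -> sigma A = sigma' A.
Proof.
move=> bk [slin _ sprin] [slin' _ sprin'] seq seq'.
have lin0 (t : diffop R M m -> symbol R M m) : linear t -> t 0 = 0.
  by move=> /GRing.zmod_morphism_linear tB; rewrite -(subrr 0) tB subrr.
suff agree N A : (N <= k.+1)%N -> A \in order_lt N -> sigma A = sigma' A.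
  by move=> A /order_leE; exact: agree.
elim: N A => [|N IHN] A Nk.
  by move/order_lt0 => ->; rewrite !lin0.
case/order_ltS => a Aa; pose B := quant1 N a.
have BA : A - B \in order_lt N.
  rewrite -[A](subrK (homop N a)) -addrA rpredD// -opprB rpredN.
  exact: quant1_top.
have bN : b N.
  by move: Nk; rewrite ltnS leq_eqVlt => /orP[/eqP->//|]; exact: b_down.
suff BE : sigma B = sigma' B.
  have sD : sigma A = sigma (A - B) + sigma B.
    by rewrite (GRing.zmod_morphism_linear slin) subrK.
  have sD' : sigma' A = sigma' (A - B) + sigma' B.
    by rewrite (GRing.zmod_morphism_linear slin') subrK.
  by rewrite sD sD' BE IHN// ltnW.
have BN : B \in order_lt N.+1 by exact: order_ltSK (quant1_top _ _).
have Bk : B \in order_lt k.+1 by exact: order_ltW BN.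
have CB : casimir B = c N *: B by rewrite /B /quant1 bN casimir_eigenproj.
have topE (t : diffop R M m -> symbol R M m) :
    (forall p A, order_le p A -> has_principal_symbol alpha p A (t A)) ->
    (forall i : mindex m N, term (t B) i = term (mix alpha a) i) /\
    (forall q (i : mindex m q), (N < q)%N -> term (t B) i = 0).
  move=> tP; have [[a' BE tE] tV] : has_principal_symbol alpha N B (t B).
    by apply: tP; exact/order_leE.
  split=> // i; rewrite tE term_mix; apply: eq_principal_symbol => j.
  (* The families [a'] and [a] both describe the leading part of [B], so [homop N] of their
     difference has order below [N]. *)
  apply/eqP; rewrite -subr_eq0 -[_ - _]/(term (a' - a) j); apply/eqP.
  apply: homop_inj; rewrite linearB /=.
  have -> : homop N a' = B - \sum_(q < N) homop q a'.
    apply/esym/eqP; rewrite subr_eq; apply/eqP/val_inj; rewrite /= BE op_of_coef_homop.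
    by rewrite big_ord_recr /= addrC.
  rewrite addrAC rpredB//; first exact: quant1_top.
  by apply/order_ltP; exists a'.
have lowE (t : diffop R M m -> symbol R M m) : linear t ->
    sl2_equivariant_on lambda mu (@order_le R M m k) t ->
    forall q (i : mindex m q), (q < N)%N -> term (t B) i = 0.
  (* The degree [q] component is multiplied by [c q] by equivariance and by [c N] by linearity; as
     these scalars differ, it vanishes. *)
  move=> tlin teq q i qN; have := symbol_map_casimir tlin teq Bk i.
  have -> : t (casimir B) = c N *: t B.
    by rewrite CB -[c N *: B]addr0 tlin (lin0 _ tlin) addr0.
  rewrite -[LHS]/(c N *: term (t B) i) => /eqP.
  rewrite -subr_eq0 -scalerBl scaler_eq0 subr_eq0 eq_sym (negbTE (b_sep bN qN)).
  by move=> /eqP.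
have [top1 high1] := topE _ sprin; have [top2 high2] := topE _ sprin'.
apply/val_inj/family_ext => q i.
have [qN|Nq|qN] := ltngtP q N.
- by rewrite (lowE _ slin seq)// (lowE _ slin' seq').
- by rewrite high1// high2.
by move: i; rewrite qN => i; rewrite -/(term _ i) -/(term _ i) top1 top2.
Qed.

End SymbolMap.

(** * Separation of the eigenvalues and the theorem *)

Lemma eigenvalue_nonresonant (R : realType) (m k : nat) (lambda : 'I_m -> R) (mu : R) :
  ~ resonant k (weight_shift lambda mu) ->
  forall p q, (p <= k)%N -> (q < p)%N ->
  eigenvalue lambda mu q != eigenvalue lambda mu p.
Proof.
move=> nres p q pk qp; apply/eqP; rewrite /eigenvalue; set d := weight_shift _ _ => E.
(* Equal eigenvalues would give delta = (p + q + 1) / 2, and q < p <= k places p + q + 1 between 2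
   and 2 k. *)
apply: nres; exists (p + q).+1.
  by rewrite ltnS addn_gt0 (leq_ltn_trans _ qp)//= -addnn -addnS leq_add// (leq_trans qp).
have : (p%:R - q%:R) * (d * 2 - (p + q).+1%:R) = 0.
  rewrite -[(p + q).+1%:R]natr1 natrD.
  transitivity ((d - q%:R) * (d - q%:R - 1) - (d - p%:R) * (d - p%:R - 1)); first by ring.
  by rewrite E subrr.
move/eqP; rewrite mulf_eq0 !subr_eq0 eqr_nat gtn_eqF//= => /eqP dE.
by rewrite -[RHS]/(_ / 2) -dE mulfK// pnatr_eq0.
Qed.

(** With equivariance imposed on D^k only, uniqueness is asserted on D^k. Without resonance at any
    order, equivariance holds on all operators and the symbol map is unique as a whole. *)
Theorem proposition4p2 (R : realType) (M : manifold) (m k : nat)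
    (m_gt0 : (1 <= m)%N) (lambda : 'I_m -> R) (mu : R)
    (alpha : forall p, 'M[R]_#|{: mindex m p}|)
    (alpha_unit : forall p, alpha p \in unitmx)
    (delta_k : ~ resonant k (weight_shift lambda mu)) :
  (exists sigma : diffop R M m -> symbol R M m,
    [/\ symbol_map alpha sigma,
        sl2_equivariant_on lambda mu (@order_le R M m k) sigma &
        forall sigma' : diffop R M m -> symbol R M m,
          symbol_map alpha sigma' ->
          sl2_equivariant_on lambda mu (@order_le R M m k) sigma' ->
          forall A : diffop R M m, order_le k A -> sigma' A = sigma A]) /\
  ((forall l, ~ resonant l (weight_shift lambda mu)) ->
   exists! sigma : diffop R M m -> symbol R M m,
     symbol_map alpha sigma /\
     sl2_equivariant_on lambda mu (fun=> True) sigma).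
Proof.
have [X0 [X1 [X2 tri]]] := sl2_triple_exists R M.
split=> [|nres].
  (* Equivariance is imposed in the degrees up to [k]. *)
  have b_down p q : (p <= k)%N -> (q < p)%N -> (q <= k)%N.
    by move=> pk /ltnW qp; exact: leq_trans pk.
  have b_sep := eigenvalue_nonresonant delta_k.
  have [sigma [sm equiv]] := symbol_map_exists tri alpha_unit b_down b_sep.
  exists sigma; split=> //; first exact: equiv.
  move=> sigma' sm' equiv'.
  apply: (symbol_map_unique tri b_down b_sep (leqnn k) sm' sm equiv').
  exact: equiv.
(* Now it is imposed in every degree; separation from the eigenvalue at [p] uses non-resonance up to
   [p]. *)
have b_sep p q : predT p -> (q < p)%N ->
    eigenvalue lambda mu q != eigenvalue lambda mu p.
  by move=> _; exact: (eigenvalue_nonresonant (nres p)).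
have b_down p q : predT p -> (q < p)%N -> predT q by [].
have [sigma [sm equiv]] := symbol_map_exists tri alpha_unit b_down b_sep.
have order_le_ex A : exists p, @order_le R M m p A.
  have [p Ap] := order_lt_ex A; exists p; apply/order_leE.
  exact: order_ltW Ap.
exists sigma; split.
  by split=> // X A sX _; have [p Ap] := order_le_ex A; exact: (equiv p).
(* Each operator has some finite order [p], and uniqueness on D^p applies to it. *)
move=> sigma' [sm' equiv']; apply/funext => A; have [p Ap] := order_le_ex A.
have eqp' : sl2_equivariant_on lambda mu (@order_le R M m p) sigma'.
  by move=> X B sX _; exact: equiv'.
exact: (symbol_map_unique tri b_down b_sep (isT : predT p) sm sm' (equiv p isT) eqp' Ap).
Qed.
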